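(* Let $\alpha,\beta\in L^\infty$. (i) If $\alpha_n,\beta_n\in L^\infty$ with $\alpha_n\to\alpha$ and $\beta_n\to\beta$ in $L^\infty$ norm, then $S_{\alpha_n,\beta_n}\to S_{\alpha,\beta}$ in operator norm. (ii) $\max\{\|\alpha\|_\infty,\|\beta\|_\infty\}\le\|S_{\alpha,\beta}\|\le\sqrt{\|\alpha\|_\infty^2+\|\beta\|_\infty^2}$. (iii) If $\alpha\bar\beta\in H^\infty$, then $\|S_{\alpha,\beta}\|=\max\{\|\alpha\|_\infty,\|\beta\|_\infty\}$. (iv) If $|\alpha|=|\beta|=$ constant (almost everywhere) and $\alpha\bar\beta\in\frac{H^{2\bot}}{H^2}$, i.e. $\alpha\bar\beta$ can be written as the quotient of a function in $H^{2\bot}$ and a (nonzero) function in $H^2$, then $\|S_{\alpha,\beta}\|=\sqrt{\|\alpha\|_\infty^2+\|\beta\|_\infty^2}$. (v) There exist $\alpha,\beta\in L^\infty$ such that $\max\{\|\alpha\|_\infty,\|\beta\|_\infty\}<\|S_{\alpha,\beta}\|<\sqrt{\|\alpha\|_\infty^2+\|\beta\|_\infty^2}$.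
   Context: $S^1=\{z\in\mathbb{C}:|z|=1\}$ carries normalized Lebesgue measure; $L^2=L^2(S^1)$, $L^\infty=L^\infty(S^1)$ (complex-valued functions), $\|\cdot\|_\infty$ is the essential supremum norm. $H^2$ is the Hardy space of all $f\in L^2$ whose negative Fourier coefficients vanish, $H^\infty=H^2\cap L^\infty$, and $H^{2\bot}$ is the orthogonal complement of $H^2$ in $L^2$. $P$ and $Q=I-P$ are the orthogonal projections of $L^2$ onto $H^2$ and $H^{2\bot}$. For $\alpha,\beta\in L^\infty$, the operator $S_{\alpha,\beta}$ on $L^2$ is $S_{\alpha,\beta}f=\alpha Pf+\beta Qf$; $\|S_{\alpha,\beta}\|$ is its operator norm. *)

(* Defs.v *)
From HB Require Import structures.
From mathcomp Require Import all_boot all_order all_algebra.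
From mathcomp Require Import complex.
From mathcomp Require Import all_classical all_reals all_analysis.
From mathcomp Require Import measurable_realfun.

Set Implicit Arguments.
Unset Strict Implicit.
Unset Printing Implicit Defensive.
Import Order.TTheory GRing.Theory Num.Theory.
Import numFieldNormedType.Exports.
Local Open Scope classical_set_scope.
Local Open Scope ring_scope.
Local Open Scope complex_scope.

Notation cabs := ComplexField.Normc.normc.

Section Circle.
Variable R : realType.

Record circle := Circle { circle_val :> R[i]; _ : cabs circle_val == 1 }.

HB.instance Definition _ := [isSub for circle_val].
HB.instance Definition _ := [Choice of circle by <:].

Lemma cabs_expi (t : R) : cabs (cos t +i* sin t) == 1.
Proof. by rewrite /= cos2Dsin2 sqrtr1. Qed.

Definition expi (t : R) : circle := Circle (cabs_expi t).

HB.instance Definition _ := isPointed.Build circle (expi 0).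

(* Preimage under the embedding in R * R of the product Borel sigma-algebra:
   this is the Borel sigma-algebra of the circle. *)
Definition circle_coord (z : circle) : measurableTypeR R * measurableTypeR R :=
  (complex.Re z, complex.Im z).

HB.instance Definition _ :=
  Measurable.copy circle (g_sigma_algebra_preimageType circle_coord).

Lemma measurable_expi :
  measurable_fun [set: measurableTypeR R] (expi : measurableTypeR R -> circle).
Proof.
move=> _ _ [B mB <-]; rewrite setTI.
have mcs : measurable_fun [set: measurableTypeR R]
    (fun t : measurableTypeR R => (cos t : measurableTypeR R,
                                   sin t : measurableTypeR R)).
  by apply/measurable_fun_pair; apply: continuous_measurable_fun;
    [exact: continuous_cos|exact: continuous_sin].
rewrite !setTI -[X in measurable X]setTI; exact: (mcs measurableT B mB).
Qed.

Definition expi_mfun : {mfun measurableTypeR R >-> circle} :=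
  HB.pack (expi : measurableTypeR R -> circle)
    (isMeasurableFun.Build _ _ _ _ _ measurable_expi).

Lemma twopi_gt0 : 0 < 2 * pi :> R.
Proof. by rewrite mulr_gt0 ?pi_gt0. Qed.

(* Normalized Lebesgue measure on the circle: the image under t |-> exp(i t)
   of the uniform probability (2 pi)^-1 dt on [0, 2 pi]. *)
Definition circle_measure : probability circle R :=
  distribution (uniform_prob twopi_gt0) expi_mfun.

(* Elements of the L^p spaces are handled through Borel representatives; the
   norms, integrals and function spaces below do not distinguish measurable
   functions that are equal almost everywhere. *)
Local Notation Fun := (circle -> R[i]).

Definition cmeasurable (f : Fun) :=
  measurable_fun setT (fun z => complex.Re (f z)) /\
  measurable_fun setT (fun z => complex.Im (f z)).

Definition cnorm (p : \bar R) (f : Fun) : \bar R :=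
  Lnorm circle_measure p (fun z => (cabs (f z))%:E).

Definition Lp (p : \bar R) : set Fun :=
  [set f | cmeasurable f /\ (cnorm p f < +oo)%E].

Definition L2 : set Fun := Lp 2%:E.
Definition Linf : set Fun := Lp +oo%E.

Definition norm_inf (f : Fun) : R := fine (cnorm +oo%E f).

Definition cintegral (f : Fun) : R[i] :=
  (\int[circle_measure]_z complex.Re (f z)) +i*
  (\int[circle_measure]_z complex.Im (f z)).

Definition cdot (f g : Fun) : R[i] :=
  cintegral (fun z => f z * (g z)^*).

Definition fourier (f : Fun) (n : int) : R[i] :=
  cdot f (fun z => (z : R[i]) ^ n).

Definition H2 : set Fun :=
  [set f | L2 f /\ forall n : int, (n < 0)%R -> fourier f n = 0].

Definition Hinf : set Fun := H2 `&` Linf.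

Definition H2perp : set Fun :=
  [set g | L2 g /\ forall h, H2 h -> cdot g h = 0].

(* Orthogonal projection of L^2 onto H^2: P f is a representative, unique up to
   almost everywhere equality, of the h in H^2 with f - h orthogonal to H^2
   (it exists for every f in L^2 because H^2 is closed). As the set of such h
   only depends on the class of f, so does P f. *)
Definition projP (f : Fun) : Fun :=
  xget (cst 0) [set h | H2 h /\ H2perp (f - h)].

Definition projQ (f : Fun) : Fun := f - projP f.

Definition Sop (alpha beta : Fun) (f : Fun) : Fun :=
  fun z => alpha z * projP f z + beta z * projQ f z.

Definition opnorm (T : Fun -> Fun) : \bar R :=
  ereal_sup [set cnorm 2%:E (T f) | f in [set f | L2 f /\ (cnorm 2%:E f <= 1)%E]].

End Circle.

(* Main.v *)
Require Import Defs.
From HB Require Import structures.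
From mathcomp Require Import all_boot all_order all_algebra.
From mathcomp Require Import complex ring lra.
From mathcomp Require Import all_classical all_reals all_analysis.
From mathcomp Require Import measurable_realfun ess_sup_inf.

Set Implicit Arguments.
Unset Strict Implicit.
Unset Printing Implicit Defensive.
Import Order.TTheory GRing.Theory Num.Theory.
Import numFieldNormedType.Exports.
Local Open Scope classical_set_scope.
Local Open Scope ring_scope.
Local Open Scope complex_scope.

(* Since L^2 = H^2 + H^2_perp orthogonally, S_{a,b} (h + g) = a h + b g for
   every h in H^2 and g in H^2_perp. The upper bound in (ii) is
   |a h + b g| <= A |h| + B |g| followed by Cauchy-Schwarz, and (i) follows
   because S is linear in (a, b). For the lower bound, multiplication by z^N
   is isometric and maps any trigonometric polynomial into H^2, so that
   |a p| <= ||S|| |p| for all trigonometric polynomials p, hence by density for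
   indicators, which gives |a| <= ||S|| almost everywhere; similarly for b.
   In (iii) the cross term <a h, b g> = <(a b^* ) h, g> vanishes because
   H^infty H^2 is contained in H^2. In (iv) one has |a h + b g| = 2 c |h| for
   g = q / c^2. For (v) take a = 1 + 1/z and b = 2.

   Density is obtained without Fejer kernels: the iterates of
   s |-> (3 s - s^3) / 2 converge on [-1, 1] to the sign function, so indicators of
   {Re z > a, Im z > b} are bounded pointwise limits of trigonometric
   polynomials, and a Dynkin class argument reaches all Borel sets.

   The projection P f need not be known to exist: when it does not, [projP f]
   is the default [cst 0], for which the upper bounds remain true, and the lower
   bounds only apply S to vectors given with their decomposition. *)

(** * Mean square norm on the circle *)

(** Working with the real number |w|^2 avoids square roots, so that most identities below are
    polynomial and fall to [ring] or [nra]. *)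
Definition sqmod (R : realType) (w : R[i]) : R := complex.Re w ^+ 2 + complex.Im w ^+ 2.

Section SquaredModulus.
Variable R : realType.
Implicit Types w v : R[i].

Lemma sqmod_ge0 w : 0 <= sqmod w.
Proof. by rewrite addr_ge0 ?sqr_ge0. Qed.

Lemma sqmodM w v : sqmod (w * v) = sqmod w * sqmod v.
Proof. by case: w v => a b [c d]; rewrite /sqmod /=; ring. Qed.

Lemma sqmodJ w : sqmod (w^*)%R = sqmod w.
Proof. by case: w => a b; rewrite /sqmod /=; ring. Qed.

Lemma sqmodN w : sqmod (- w) = sqmod w.
Proof. by case: w => a b; rewrite /sqmod /=; ring. Qed.

Lemma cabsE w : cabs w = Num.sqrt (sqmod w).
Proof. by case: w. Qed.

Lemma sqr_cabs w : cabs w ^+ 2 = sqmod w.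
Proof. by rewrite cabsE sqr_sqrtr // sqmod_ge0. Qed.

Lemma sqmod_eq0 w : sqmod w = 0 -> w = 0.
Proof.
case: w => a b /eqP; rewrite /sqmod /= paddr_eq0 ?sqr_ge0 // !sqrf_eq0.
by case/andP => /eqP -> /eqP ->.
Qed.

Lemma sqmodD_le w v : sqmod (w + v) <= 2 * (sqmod w + sqmod v).
Proof.
case: w v => a b [c d]; rewrite /sqmod /= -subr_ge0.
by rewrite (_ : _ - _ = (a - c) ^+ 2 + (b - d) ^+ 2); [rewrite addr_ge0 ?sqr_ge0 | ring].
Qed.

Lemma mulcJ w : w * w^* = (sqmod w)%:C.
Proof. by case: w => a b; rewrite /sqmod; apply/eqP; rewrite eq_complex /=; apply/andP; split; apply/eqP; ring. Qed.

(** The constant is not sharp: the bound serves to dominate the integrand of an inner product when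
    its integrability is checked. *)
Lemma Re_mulJ_le w v : `|complex.Re (w * v^*)| <= sqmod w + sqmod v.
Proof.
case: w v => a b [c d]; rewrite /sqmod /= ler_norml.
have := sqr_ge0 (a + c); have := sqr_ge0 (a - c).
have := sqr_ge0 (b + d); have := sqr_ge0 (b - d).
have := sqr_ge0 a; have := sqr_ge0 b; have := sqr_ge0 c; have := sqr_ge0 d.
by move=> *; apply/andP; split; nra.
Qed.

Lemma Im_mulJ_le w v : `|complex.Im (w * v^*)| <= sqmod w + sqmod v.
Proof.
(* Multiplying v by i turns the imaginary part into a real part and keeps |v|. *)
rewrite (_ : complex.Im (w * v^*) = complex.Re (w * ('i * v)^*)); last first.
  by case: w v => a b [c d] /=; ring.
rewrite (_ : sqmod v = sqmod ('i * v)); first exact: Re_mulJ_le.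
by rewrite sqmodM /sqmod /=; ring.
Qed.

End SquaredModulus.

Section MeanSquare.
Variable R : realType.
Local Notation T := (circle R).
Local Notation mu := (circle_measure R).
Local Notation C := R[i].
Local Notation Fun := (T -> C).
Local Notation Re := complex.Re.
Local Notation Im := complex.Im.
Local Notation Rintegrable f := (mu.-integrable setT (EFin \o f)).
Implicit Types (f g h : Fun) (u v : T -> R).

Lemma Rintegrable_le u v : measurable_fun setT u -> (forall z, `|u z| <= v z) ->
  Rintegrable v -> Rintegrable u.
Proof.
move=> mu_ uv; apply: le_integrable => //; first exact/measurable_EFinP.
by move=> z _; rewrite !abse_EFin lee_fin (le_trans (uv z)) // ler_norm.
Qed.

Lemma eq_Rintegrable u v : u =1 v -> Rintegrable u -> Rintegrable v.
Proof. by move=> /funext ->. Qed.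

Lemma RintegrableD u v : Rintegrable u -> Rintegrable v -> Rintegrable (fun z => u z + v z).
Proof. by move=> iu iv; apply: (eq_integrable _ _ _ _ (integrableD measurableT iu iv)). Qed.

Lemma RintegrableB u v : Rintegrable u -> Rintegrable v -> Rintegrable (fun z => u z - v z).
Proof. by move=> iu iv; apply: (eq_integrable _ _ _ _ (integrableB measurableT iu iv)). Qed.

Lemma RintegrableZ (k : R) u : Rintegrable u -> Rintegrable (fun z => k * u z).
Proof. by move=> iu; apply: (eq_integrable _ _ _ _ (integrableZl measurableT k iu)). Qed.

Lemma Rintegrable_cst (k : R) : Rintegrable (fun _ => k).
Proof. exact: finite_measure_integrable_cst. Qed.

Lemma Rintegrable_measurable u : Rintegrable u -> measurable_fun setT u.
Proof. by move/measurable_int/measurable_EFinP. Qed.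

Lemma circle_intD u v : Rintegrable u -> Rintegrable v ->
  \int[mu]_z (u z + v z) = \int[mu]_z u z + \int[mu]_z v z.
Proof. by move=> iu iv; rewrite -RintegralD. Qed.

Lemma circle_intB u v : Rintegrable u -> Rintegrable v ->
  \int[mu]_z (u z - v z) = \int[mu]_z u z - \int[mu]_z v z.
Proof. by move=> iu iv; rewrite -RintegralB. Qed.

Lemma circle_intZ (k : R) u : Rintegrable u -> \int[mu]_z (k * u z) = k * \int[mu]_z u z.
Proof. by move=> iu; rewrite -RintegralZl. Qed.

Lemma EFin_int u : Rintegrable u -> (\int[mu]_z (u z)%:E)%E = (\int[mu]_z u z)%:E.
Proof. by move=> iu; rewrite /Rintegral fineK //; apply: integrable_fin_num. Qed.

Definition sqnorm (f : Fun) : R := \int[mu]_z sqmod (f z).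

Lemma sqnorm_ge0 f : 0 <= sqnorm f.
Proof. by apply: Rintegral_ge0 => z _; exact: sqmod_ge0. Qed.

Lemma cmeas_sqmod f : cmeasurable f -> measurable_fun setT (fun z => sqmod (f z)).
Proof. by case=> m1 m2; apply: measurable_funD; exact: measurable_funX. Qed.

Lemma cmeasD f g : cmeasurable f -> cmeasurable g -> cmeasurable (f + g).
Proof.
move=> [f1 f2] [g1 g2]; split.
- rewrite (_ : (fun z => _) = (fun z => Re (f z) + Re (g z))); first exact: measurable_funD.
  by apply/funext => z; rewrite fctE; case: (f z) (g z) => ? ? [].
- rewrite (_ : (fun z => _) = (fun z => Im (f z) + Im (g z))); first exact: measurable_funD.
  by apply/funext => z; rewrite fctE; case: (f z) (g z) => ? ? [].
Qed.

Lemma cmeasM f g : cmeasurable f -> cmeasurable g -> cmeasurable (f * g).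
Proof.
move=> [f1 f2] [g1 g2]; split.
- rewrite (_ : (fun z => _) = (fun z => Re (f z) * Re (g z) - Im (f z) * Im (g z))).
    by apply: measurable_funB; exact: measurable_funM.
  by apply/funext => z; rewrite fctE; case: (f z) (g z) => ? ? [].
- rewrite (_ : (fun z => _) = (fun z => Re (f z) * Im (g z) + Im (f z) * Re (g z))).
    by apply: measurable_funD; exact: measurable_funM.
  by apply/funext => z; rewrite fctE; case: (f z) (g z) => ? ? [].
Qed.

Lemma cmeas_cst (c : C) : cmeasurable (cst c : Fun).
Proof. by split; exact: measurable_cst. Qed.

Lemma cmeasJ f : cmeasurable f -> cmeasurable (fun z => ((f z)^*)%R).
Proof.
move=> [f1 f2]; split.
- by rewrite (_ : (fun z => _) = (fun z => Re (f z))) //; apply/funext => z; case: (f z).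
- rewrite (_ : (fun z => _) = (fun z => - Im (f z))); first exact: measurableT_comp.
  by apply/funext => z; case: (f z).
Qed.

Lemma cnorm2E f : cnorm 2%:E f = (((\int[mu]_z (sqmod (f z))%:E)%E) `^ 2^-1)%E.
Proof.
rewrite /cnorm unlock; congr (_ `^ _)%E; apply: eq_integral => z _.
by rewrite abse_EFin poweR_EFin powR_mulrn ?normr_ge0 // real_normK ?num_real // sqr_cabs.
Qed.

Lemma L2P f : L2 f <-> cmeasurable f /\ Rintegrable (fun z => sqmod (f z)).
Proof.
have pos z : (0 <= (sqmod (f z))%:E)%E by rewrite lee_fin sqmod_ge0.
split=> [[mf]|[mf fi]].
  rewrite cnorm2E => fin; split=> //; apply/integrableP; split.
    exact/measurable_EFinP/cmeas_sqmod.
  under eq_integral do rewrite /= ger0_norm ?sqmod_ge0 //.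
  rewrite ltNge leye_eq; apply/eqP => E; move: fin; rewrite E.
  by rewrite poweRyr ?invr_eq0 ?pnatr_eq0.
by split=> //; rewrite cnorm2E EFin_int // poweR_EFin ltry.
Qed.

Lemma L2_cmeasurable f : L2 f -> cmeasurable f. Proof. by case. Qed.
Lemma L2_Rintegrable f : L2 f -> Rintegrable (fun z => sqmod (f z)). Proof. by move/L2P => []. Qed.
#[local] Hint Resolve L2_Rintegrable : core.

Lemma cnorm2_sqrt f : L2 f -> cnorm 2%:E f = (Num.sqrt (sqnorm f))%:E.
Proof.
by move=> /L2P[_ fi]; rewrite cnorm2E EFin_int // poweR_EFin powR12_sqrt // sqnorm_ge0.
Qed.

Lemma L2D f g : L2 f -> L2 g -> L2 (f + g).
Proof.
move=> /L2P[mf fi] /L2P[mg gi]; apply/L2P; split; first exact: cmeasD.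
apply: (@Rintegrable_le _ (fun z => 2 * (sqmod (f z) + sqmod (g z)))).
- exact/cmeas_sqmod/cmeasD.
- by move=> z; rewrite ger0_norm ?sqmod_ge0 // sqmodD_le.
- exact/RintegrableZ/RintegrableD.
Qed.

(** Here the bound on f holds at every point; [L2_LinfM] is the version for a bound almost
    everywhere. *)
Lemma L2_bndM (K : R) f g : cmeasurable f ->
  (forall z, sqmod (f z) <= K) -> L2 g -> L2 (f * g).
Proof.
move=> mf fK /L2P[mg gi]; apply/L2P; split; first exact: cmeasM.
apply: (@Rintegrable_le _ (fun z => K * sqmod (g z))); last exact/RintegrableZ.
- exact/cmeas_sqmod/cmeasM.
- by move=> z; rewrite ger0_norm ?sqmod_ge0 // sqmodM ler_wpM2r ?sqmod_ge0.
Qed.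

Lemma L2Z (c : C) f : L2 f -> L2 (fun z => c * f z).
Proof. by apply: (@L2_bndM (sqmod c) (cst c)) => //; exact: cmeas_cst. Qed.

Lemma L2N f : L2 f -> L2 (- f).
Proof.
by move/(L2Z (-1)); rewrite (_ : (fun _ => _) = - f) //; apply/funext => z; rewrite mulN1r.
Qed.

Lemma L2B f g : L2 f -> L2 g -> L2 (f - g).
Proof. by move=> Hf Hg; apply: L2D => //; exact: L2N. Qed.

Lemma L2_cst (c : C) : L2 (cst c : Fun).
Proof. by apply/L2P; split; [exact: cmeas_cst|exact: (Rintegrable_cst (sqmod c))]. Qed.

Lemma L2_bounded (K : R) f : cmeasurable f -> (forall z, sqmod (f z) <= K) -> L2 f.
Proof.
move=> mf fK; have := L2_bndM mf fK (L2_cst 1).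
by rewrite (_ : f * _ = f) //; apply/funext => z; rewrite fctE mulr1.
Qed.

Lemma Rintegrable_Re_dot f g : L2 f -> L2 g -> Rintegrable (fun z => Re (f z * (g z)^*)).
Proof.
move=> /L2P[mf fi] /L2P[mg gi].
apply: (@Rintegrable_le _ (fun z => sqmod (f z) + sqmod (g z))); last exact: RintegrableD.
- by have [] := cmeasM mf (cmeasJ mg).
- by move=> z; exact: Re_mulJ_le.
Qed.

Lemma Rintegrable_Im_dot f g : L2 f -> L2 g -> Rintegrable (fun z => Im (f z * (g z)^*)).
Proof.
move=> /L2P[mf fi] /L2P[mg gi].
apply: (@Rintegrable_le _ (fun z => sqmod (f z) + sqmod (g z))); last exact: RintegrableD.
- by have [] := cmeasM mf (cmeasJ mg).
- by move=> z; exact: Im_mulJ_le.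
Qed.
#[local] Hint Resolve Rintegrable_Re_dot Rintegrable_Im_dot : core.

Lemma cdotDl f g h : L2 f -> L2 g -> L2 h -> cdot (f + g) h = cdot f h + cdot g h.
Proof.
move=> Hf Hg Hh; rewrite /cdot /cintegral; apply/eqP; rewrite eq_complex /=.
rewrite -!circle_intD; [|exact: Rintegrable_Im_dot..|exact: Rintegrable_Re_dot|exact: Rintegrable_Re_dot].
by apply/andP; split; apply/eqP; apply: eq_Rintegral => z _;
  rewrite fctE mulrDl; case: (f z * _) (g z * _) => ? ? [].
Qed.

Lemma cdotZl (c : C) f h : L2 f -> L2 h -> cdot (fun z => c * f z) h = c * cdot f h.
Proof.
move=> Hf Hh; rewrite /cdot /cintegral; case: c => a b; apply/eqP; rewrite eq_complex /=.
have i1 := Rintegrable_Re_dot Hf Hh; have i2 := Rintegrable_Im_dot Hf Hh.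
rewrite -!circle_intZ // -circle_intD -?circle_intB; try exact: RintegrableZ.
apply/andP; split; apply/eqP; apply: eq_Rintegral => z _; rewrite -mulrA;
  by case: (f z * _).
Qed.


Lemma cdotC f g : L2 f -> L2 g -> cdot g f = ((cdot f g)^*)%R.
Proof.
move=> Hf Hg; rewrite /cdot /cintegral /=; apply/eqP; rewrite eq_complex /=.
rewrite -mulN1r -circle_intZ; last exact: Rintegrable_Im_dot.
by apply/andP; split; apply/eqP; apply: eq_Rintegral => z _;
  case: (f z) (g z) => a b [c d] /=; ring.
Qed.

Lemma cdotDr f g h : L2 f -> L2 g -> L2 h -> cdot h (f + g) = cdot h f + cdot h g.
Proof.
by move=> Hf Hg Hh; rewrite (cdotC _ Hh) ?(cdotC Hf Hh) ?(cdotC Hg Hh) ?cdotDl ?rmorphD //; exact: L2D.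
Qed.

Lemma cdotZr (c : C) f h : L2 f -> L2 h -> cdot h (fun z => c * f z) = c^* * cdot h f.
Proof.
by move=> Hf Hh; rewrite (cdotC _ Hh) ?(cdotC Hf Hh) ?cdotZl ?rmorphM //; exact: L2Z.
Qed.

Lemma cdotNl f h : L2 f -> L2 h -> cdot (- f) h = - cdot f h.
Proof.
move=> Hf Hh; rewrite -[RHS]mulN1r -cdotZl //; congr cdot.
by apply/funext => z; rewrite mulN1r.
Qed.

Lemma cdotNr f h : L2 f -> L2 h -> cdot h (- f) = - cdot h f.
Proof.
by move=> Hf Hh; rewrite (cdotC _ Hh) ?(cdotC Hf Hh) ?cdotNl ?rmorphN //; exact: L2N.
Qed.

Lemma cdotBl f g h : L2 f -> L2 g -> L2 h -> cdot (f - g) h = cdot f h - cdot g h.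
Proof. by move=> Hf Hg Hh; rewrite cdotDl ?cdotNl //; exact: L2N. Qed.

Lemma cdotff f : cdot f f = (sqnorm f)%:C.
Proof.
rewrite /cdot /cintegral /sqnorm; apply/eqP; rewrite eq_complex /=; apply/andP; split; apply/eqP.
  by apply: eq_Rintegral => z _; rewrite mulcJ.
rewrite -[RHS](mul0r (fine (mu setT))) -Rintegral_cst //.
by apply: eq_Rintegral => z _; rewrite mulcJ.
Qed.

Lemma sqnormD f g : L2 f -> L2 g -> sqnorm (f + g) = sqnorm f + sqnorm g + 2 * Re (cdot f g).
Proof.
move=> Hf Hg; have Hfg := L2D Hf Hg.
have := cdotff (f + g); rewrite cdotDl // !cdotDr // !cdotff (cdotC Hf Hg).
case: (cdot f g) => a b /eqP; rewrite eq_complex /= => /andP[/eqP <- _]; ring.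
Qed.

Lemma sqnormZ (c : C) f : L2 f -> sqnorm (fun z => c * f z) = sqmod c * sqnorm f.
Proof.
by move=> Hf; rewrite /sqnorm -circle_intZ //; [apply: eq_Rintegral => z _; rewrite sqmodM | exact: L2_Rintegrable].
Qed.

Lemma sqnormN f : sqnorm (- f) = sqnorm f.
Proof. by apply: eq_Rintegral => z _; exact: sqmodN. Qed.

Lemma sqnormB f g : L2 f -> L2 g -> sqnorm (f - g) = sqnorm f + sqnorm g - 2 * Re (cdot f g).
Proof.
move=> Hf Hg; rewrite sqnormD ?sqnormN ?cdotNr //; [|exact: L2N..].
by case: cdot => a b /=; ring.
Qed.

(** For c = <f, g> and real t, expanding |f - t c g|^2 >= 0 gives a real quadratic in t. *)
Lemma cauchy_schwarz f g : L2 f -> L2 g -> sqmod (cdot f g) <= sqnorm f * sqnorm g.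
Proof.
move=> Hf Hg; set c := cdot f g.
have Hk (t : R) : 0 <= sqnorm f + t ^+ 2 * sqmod c * sqnorm g - 2 * (t * sqmod c).
  have HG : L2 (fun z => (t%:C * c) * g z) by exact: L2Z.
  have := sqnorm_ge0 (f - (fun z => (t%:C * c) * g z)).
  rewrite sqnormB // sqnormZ // cdotZr // -/c sqmodM.
  rewrite (_ : Re _ = t * sqmod c); last by case: c {HG} => a b; rewrite /sqmod /=; ring.
  by rewrite (_ : sqmod t%:C = t ^+ 2) //; rewrite /sqmod /=; ring.
have [g0|g0] := eqVneq (sqnorm g) 0.
  rewrite g0 mulr0 leNgt; apply/negP => c0.
  (* With |g| = 0 the quadratic is affine in t, and this t makes it equal to - |f|^2 - 2. *)
  have := Hk ((sqnorm f + 1) / sqmod c); rewrite g0 mulr0 divfK ?gt_eqF //.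
  by have := sqnorm_ge0 f; lra.
have gp : 0 < sqnorm g by rewrite lt_def g0 sqnorm_ge0.
(* This t minimises the quadratic. *)
have := Hk (sqnorm g)^-1; rewrite -(ler_pM2r gp) mul0r.
rewrite (_ : (_ - _) * sqnorm g = sqnorm f * sqnorm g - sqmod c) ?subr_ge0 //.
by field.
Qed.

Lemma Re_cdot_le f g : L2 f -> L2 g ->
  `|Re (cdot f g)| <= Num.sqrt (sqnorm f) * Num.sqrt (sqnorm g).
Proof.
move=> Hf Hg; rewrite -sqrtrM ?sqnorm_ge0 // -sqrtr_sqr ler_wsqrtr //.
apply: le_trans (cauchy_schwarz Hf Hg).
by rewrite /sqmod lerDl sqr_ge0.
Qed.

Lemma sqnorm_triangle f g : L2 f -> L2 g ->
  Num.sqrt (sqnorm (f + g)) <= Num.sqrt (sqnorm f) + Num.sqrt (sqnorm g).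
Proof.
move=> Hf Hg; rewrite -[leRHS]ger0_norm ?addr_ge0 ?sqrtr_ge0 // -sqrtr_sqr ler_wsqrtr //.
rewrite sqnormD // sqrrD !sqr_sqrtr ?sqnorm_ge0 //.
have := Re_cdot_le Hf Hg; rewrite ler_norml => /andP[_ h].
by rewrite -mulr_natl; lra.
Qed.

(** The cross term vanishes by Cauchy-Schwarz. This makes null perturbations harmless without
    passing to almost everywhere equality. *)
Lemma sqnorm_null f g : L2 f -> L2 g -> sqnorm g = 0 -> sqnorm (f + g) = sqnorm f.
Proof.
move=> Hf Hg g0; rewrite sqnormD // g0.
by have := Re_cdot_le Hf Hg; rewrite g0 sqrtr0 mulr0 normr_le0 => /eqP ->; ring.
Qed.

Lemma sqnorm_ae f g : L2 f -> L2 g -> {ae mu, forall z, f z = g z} -> sqnorm f = sqnorm g.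
Proof.
move=> Hf Hg fg; rewrite /sqnorm /Rintegral; congr fine.
apply: ae_eq_integral => //; [exact/measurable_EFinP/cmeas_sqmod/L2_cmeasurable..|].
by apply: filterS fg => z -> .
Qed.

Lemma sqnorm_eq0 f : L2 f -> sqnorm f = 0 -> {ae mu, forall z, f z = 0}.
Proof.
move=> Hf f0.
have mf : measurable_fun setT (fun z => (sqmod (f z))%:E).
  exact/measurable_EFinP/cmeas_sqmod/L2_cmeasurable.
have /(ae_eq_integral_abs mu measurableT mf) : (\int[mu]_z `|(sqmod (f z))%:E| = 0)%E.
  under eq_integral do rewrite abse_EFin ger0_norm ?sqmod_ge0 //.
  by rewrite EFin_int -?/(sqnorm f) ?f0 //; exact: L2_Rintegrable.
apply: filterS => z /(_ I) [].
exact: sqmod_eq0.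
Qed.

(** * Essential supremum norm and multiplication by bounded functions *)

Lemma cabs_ge0 (w : C) : 0 <= cabs w.
Proof. by rewrite cabsE sqrtr_ge0. Qed.

Lemma cnorm_infE f : cnorm +oo%E f = ess_sup mu (fun z => (cabs (f z))%:E).
Proof.
rewrite /cnorm unlock /= ifT; last by rewrite probability_setT.
by congr ess_sup; apply/funext => z /=; rewrite ger0_norm ?cabs_ge0.
Qed.

Lemma norm_inf_ge0 f : 0 <= norm_inf f.
Proof. by rewrite /norm_inf fine_ge0 // Lnorm_ge0. Qed.

(** Finiteness of the norm is what makes [fine] faithful, since [fine] sends +oo to 0. *)
Lemma EFin_norm_inf f : Linf f -> (norm_inf f)%:E = cnorm +oo%E f.
Proof. by case=> _ fin; rewrite /norm_inf fineK // ge0_fin_numE // Lnorm_ge0. Qed.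

Lemma norm_infP f : Linf f -> {ae mu, forall z, cabs (f z) <= norm_inf f}.
Proof.
move=> Hf; have := ess_sup_ge mu (fun z => (cabs (f z))%:E).
by apply: filterS => z; rewrite -cnorm_infE -EFin_norm_inf // lee_fin.
Qed.

Lemma cnorm_inf_le (K : R) f : {ae mu, forall z, cabs (f z) <= K} -> (cnorm +oo f <= K%:E)%E.
Proof.
by move=> h; rewrite cnorm_infE; apply/ess_supP; apply: filterS h => z; rewrite lee_fin.
Qed.

Lemma norm_inf_le (K : R) f : Linf f -> {ae mu, forall z, cabs (f z) <= K} -> norm_inf f <= K.
Proof. by move=> Hf /cnorm_inf_le; rewrite -EFin_norm_inf // lee_fin. Qed.

Lemma Linf_ae (K : R) f : cmeasurable f -> {ae mu, forall z, cabs (f z) <= K} -> Linf f.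
Proof. by move=> mf /cnorm_inf_le h; split=> //; apply: le_lt_trans h (ltry _). Qed.

Lemma LinfB f g : Linf f -> Linf g -> Linf (f - g).
Proof.
move=> Hf Hg; apply: (@Linf_ae (norm_inf f + norm_inf g)).
  case: Hf Hg => mf _ [mg _]; apply: cmeasD => //.
  have := cmeasM (cmeas_cst (-1)) mg.
  by rewrite (_ : cst (-1) * g = - g) //; apply/funext => z; rewrite fctE mulN1r.
apply: filterS2 (norm_infP Hf) (norm_infP Hg) => z h1 h2.
rewrite !fctE (le_trans (le_normcD _ _)) // normcN lerD //.
Qed.

Lemma sqmod_norm_inf a : Linf a -> {ae mu, forall z, sqmod (a z) <= norm_inf a ^+ 2}.
Proof.
move=> Ha; apply: filterS (norm_infP Ha) => z h.
by rewrite -sqr_cabs lerXn2r ?nnegrE ?cabs_ge0 ?norm_inf_ge0.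
Qed.

(** The bound on |a| holds only almost everywhere, hence a comparison of integrals up to a null
    set. *)
Lemma L2_LinfM a f : Linf a -> L2 f -> L2 (a * f).
Proof.
move=> Ha /L2P[mf fi]; have ma : cmeasurable a by case: Ha.
have maf := cmeasM ma mf.
apply/L2P; split=> //; apply/integrableP; split; first exact/measurable_EFinP/cmeas_sqmod.
have /integrableP[_ fin] := RintegrableZ (norm_inf a ^+ 2) fi.
apply: le_lt_trans fin; apply: ae_ge0_le_integral => //=.
- exact/measurable_EFinP/measurableT_comp/cmeas_sqmod.
- exact/measurable_EFinP/measurableT_comp/measurable_funM/cmeas_sqmod.
- apply: filterS (sqmod_norm_inf Ha) => z h _; rewrite lee_fin !ger0_norm ?sqmod_ge0 //.
    by rewrite sqmodM ler_wpM2r ?sqmod_ge0.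
  by rewrite mulr_ge0 ?sqr_ge0 ?sqmod_ge0.
Qed.

Lemma sqnorm_LinfM a f : Linf a -> L2 f -> sqnorm (a * f) <= norm_inf a ^+ 2 * sqnorm f.
Proof.
move=> Ha Hf; have Haf := L2_LinfM Ha Hf.
rewrite -lee_fin /sqnorm -circle_intZ; last exact: L2_Rintegrable.
rewrite -!EFin_int; [|exact/RintegrableZ/L2_Rintegrable|exact: L2_Rintegrable].
apply: ae_ge0_le_integral => //=.
- by move=> z _; rewrite lee_fin sqmod_ge0.
- exact/measurable_EFinP/cmeas_sqmod/L2_cmeasurable.
- by move=> z _; rewrite lee_fin mulr_ge0 ?sqr_ge0 ?sqmod_ge0.
- exact/measurable_EFinP/measurable_funM/cmeas_sqmod/L2_cmeasurable.
- apply: filterS (sqmod_norm_inf Ha) => z h _.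
  by rewrite lee_fin sqmodM ler_wpM2r ?sqmod_ge0.
Qed.

End MeanSquare.

(** * Operators [Sop] and their norms *)

Section SingularIntegralOperator.
Variable R : realType.
Local Notation T := (circle R).
Local Notation mu := (circle_measure R).
Local Notation C := R[i].
Local Notation Fun := (T -> C).
Local Notation Re := complex.Re.
Local Notation Im := complex.Im.
Implicit Types (a b f g h p q : Fun).

Lemma H2_L2 f : H2 f -> L2 f. Proof. by case. Qed.
Lemma H2perp_L2 f : H2perp f -> L2 f. Proof. by case. Qed.
#[local] Hint Resolve H2_L2 H2perp_L2 : core.

Lemma Rintegral_0 (u : T -> R) : (forall z, u z = 0) -> \int[mu]_z u z = 0.
Proof. by move=> u0; rewrite (eq_Rintegral mu (fun _ _ => u0 _)) Rintegral_cst // mul0r. Qed.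

Lemma cdot0l f : cdot (cst 0) f = 0.
Proof.
by rewrite /cdot /cintegral; congr Complex; apply: Rintegral_0 => z; rewrite mul0r.
Qed.

Lemma cdot0r f : cdot f (cst 0) = 0.
Proof.
by rewrite /cdot /cintegral; congr Complex; apply: Rintegral_0 => z;
  rewrite [X in _ * X]rmorph0 mulr0.
Qed.

Lemma H2_0 : H2 (cst 0 : Fun).
Proof. by split=> [|n _]; [exact: L2_cst | exact: cdot0l]. Qed.

Lemma sqmod_circle (z : T) : sqmod (z : C) = 1.
Proof. by rewrite -sqr_cabs (eqP (valP z)) expr1n. Qed.

Lemma circle_neq0 (z : T) : (z : C) != 0.
Proof.
apply/eqP => z0; have /eqP := sqmod_circle z.
by rewrite z0 /sqmod /= expr0n addr0 eq_sym oner_eq0.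
Qed.

Lemma conj_circle (z : T) : ((z : C)^*)%R = (z : C)^-1.
Proof.
have zz : (z : C) * (z : C)^* = 1 by rewrite mulcJ sqmod_circle.
by rewrite -[LHS](mulKf (circle_neq0 z)) zz mulr1.
Qed.

Lemma conj_expz (z : T) (n : int) : (((z : C) ^ n)^*)%R = (z : C) ^ (- n).
Proof.
have zn (m : nat) : (((z : C) ^+ m)^*)%R = (z : C) ^- m by rewrite rmorphXn /= conj_circle exprVn.
case: n => m; first by rewrite -exprnN; exact: zn.
by rewrite NegzE opprK -exprnN fmorphV /= zn invrK.
Qed.

Lemma sqmod_expz (z : T) (n : int) : sqmod ((z : C) ^ n) = 1.
Proof.
apply: (@complexI R); rewrite -mulcJ conj_expz -expfzDr ?circle_neq0 //.
by rewrite subrr expr0z.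
Qed.

Lemma cmeas_expz (n : int) : cmeasurable (fun z : T => (z : C) ^ n).
Proof.
have mz : cmeasurable (fun z : T => (z : C)).
  have mc : measurable_fun setT (@circle_coord R).
    by move=> _ B mB; rewrite setTI; exists B => //; rewrite setTI.
  by split; [exact: (measurableT_comp measurable_fst mc) |
             exact: (measurableT_comp measurable_snd mc)].
have mN (m : nat) : cmeasurable (fun z : T => (z : C) ^+ m).
  elim: m => [|m IH]; first exact: (cmeas_cst (1 : C)).
  have := cmeasM mz IH.
  by rewrite (_ : _ * _ = (fun z : T => (z : C) ^+ m.+1)) //; apply/funext => z; rewrite fctE exprS.
case: n => m; first exact: mN.
rewrite (_ : (fun _ => _) = (fun z : T => (((z : C) ^+ m.+1)^*)%R)); first exact: cmeasJ.
by apply/funext => z; rewrite (conj_expz z m.+1) NegzE.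
Qed.

Lemma L2_expz (n : int) : L2 (fun z : T => (z : C) ^ n).
Proof.
by apply: (@L2_bounded _ 1); [exact: cmeas_expz | move=> z; rewrite sqmod_expz].
Qed.

Lemma H2B f g : H2 f -> H2 g -> H2 (f - g).
Proof.
move=> [Hf f0] [Hg g0]; split=> [|n n0]; first exact: L2B.
by rewrite /fourier cdotBl //; [rewrite -!/(fourier _ _) f0 ?g0 ?subr0|exact: L2_expz].
Qed.

Lemma H2Z (c : C) f : H2 f -> H2 (fun z => c * f z).
Proof.
move=> [Hf f0]; split=> [|n n0]; first exact: L2Z.
by rewrite /fourier cdotZl //; [rewrite -!/(fourier _ _) f0 ?mulr0|exact: L2_expz].
Qed.

Lemma H2perpB f g : H2perp f -> H2perp g -> H2perp (f - g).
Proof.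
move=> [Hf f0] [Hg g0]; split=> [|h Hh]; first exact: L2B.
by rewrite cdotBl ?f0 ?g0 ?subr0 //; exact: H2_L2.
Qed.

Lemma H2perpZ (c : C) f : H2perp f -> H2perp (fun z => c * f z).
Proof.
move=> [Hf f0]; split=> [|h Hh]; first exact: L2Z.
by rewrite cdotZl ?f0 ?mulr0 //; exact: H2_L2.
Qed.

Lemma projP_H2 f : H2 (projP f).
Proof. by rewrite /projP; case: xgetP => [h _ []|_] //; exact: H2_0. Qed.
#[local] Hint Resolve projP_H2 : core.

(** The second case is the default value of [xget], where [projQ f] is f itself. *)
Lemma projQ_perp f : H2perp (projQ f) \/ projP f = cst 0.
Proof. by rewrite /projQ /projP; case: xgetP => [h -> [_ ?]|_]; [left|right]. Qed.

Lemma projQ_L2 f : L2 f -> L2 (projQ f).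
Proof. by move=> Hf; apply: L2B => //; exact: H2_L2. Qed.
#[local] Hint Resolve projQ_L2 : core.

(** Orthogonality survives the default case, since [projP f] is then 0; the Pythagorean identity
    that follows therefore holds for every f in L^2. *)
Lemma cdot_projQP f : cdot (projQ f) (projP f) = 0.
Proof. by have [[_ ->]|->] := projQ_perp f; rewrite ?cdot0r. Qed.

Lemma sqnorm_projPQ f : L2 f -> sqnorm f = sqnorm (projP f) + sqnorm (projQ f).
Proof.
move=> Hf; have {1}-> : f = projQ f + projP f by rewrite subrK.
rewrite sqnormD //; [|exact: projQ_L2|exact: H2_L2].
by rewrite cdot_projQP /=; ring.
Qed.

Lemma SopE a b f : Sop a b f = a * projP f + b * projQ f.
Proof. by []. Qed.

Lemma L2_Sop a b f : Linf a -> Linf b -> L2 f -> L2 (Sop a b f).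
Proof.
by move=> Ha Hb Hf; rewrite SopE; apply: L2D; apply: L2_LinfM => //; [exact: H2_L2|exact: projQ_L2].
Qed.

Lemma sqrt_le_scaled (A s t : R) : 0 <= A -> s <= A ^+ 2 * t ->
  Num.sqrt s <= A * Num.sqrt t.
Proof.
by move=> A0 h; rewrite -[A]ger0_norm // -sqrtr_sqr -sqrtrM ?sqr_ge0 // ler_wsqrtr.
Qed.

Lemma sqnorm_Sop_le a b f : Linf a -> Linf b -> L2 f ->
  sqnorm (Sop a b f) <= (norm_inf a ^+ 2 + norm_inf b ^+ 2) * sqnorm f.
Proof.
move=> Ha Hb Hf; have HP := H2_L2 (projP_H2 f); have HQ := projQ_L2 Hf.
have HaP := L2_LinfM Ha HP; have HbQ := L2_LinfM Hb HQ.
rewrite SopE (sqnorm_projPQ Hf).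
have hP := sqrt_le_scaled (norm_inf_ge0 a) (sqnorm_LinfM Ha HP).
have hQ := sqrt_le_scaled (norm_inf_ge0 b) (sqnorm_LinfM Hb HQ).
have {hP hQ} := le_trans (sqnorm_triangle HaP HbQ) (lerD hP hQ).
rewrite -[X in _ -> X <= _](sqr_sqrtr (sqnorm_ge0 _)) -[X in _ -> _ <= _ * (X + _)](sqr_sqrtr (sqnorm_ge0 _)).
rewrite -[X in _ -> _ <= _ * (_ + X)](sqr_sqrtr (sqnorm_ge0 _)).
have := norm_inf_ge0 a; have := norm_inf_ge0 b.
move: (sqrtr_ge0 (sqnorm (projP f))) (sqrtr_ge0 (sqnorm (projQ f))) (sqrtr_ge0 (sqnorm (a * projP f + b * projQ f))).
move: (Num.sqrt _) (Num.sqrt _) (Num.sqrt _) (norm_inf a) (norm_inf b) => s y x A B x0 y0 s0 B0 A0 hs.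
have : s ^+ 2 <= (A * x + B * y) ^+ 2 by rewrite lerXn2r ?nnegrE ?addr_ge0 ?mulr_ge0.
move=> h; apply: le_trans h _.
(* Lagrange's identity, which is Cauchy-Schwarz in the plane. *)
by rewrite -subr_ge0 (_ : _ - _ = (A * y - B * x) ^+ 2) ?sqr_ge0 //; ring.
Qed.

Lemma opnorm_ub (K : R) (S : Fun -> Fun) : 0 <= K ->
  (forall f, L2 f -> L2 (S f) /\ sqnorm (S f) <= K ^+ 2 * sqnorm f) ->
  (opnorm S <= K%:E)%E.
Proof.
move=> K0 SK; apply: ge_ereal_sup => _ [f [Hf f1] <-].
have [HSf h] := SK f Hf.
rewrite cnorm2_sqrt // lee_fin; move: f1; rewrite cnorm2_sqrt // lee_fin => f1.
rewrite -[K]ger0_norm // -sqrtr_sqr ler_wsqrtr //; apply: le_trans h _.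
rewrite ler_piMr ?sqr_ge0 //.
by rewrite -(sqr_sqrtr (sqnorm_ge0 f)) exprn_ile1 ?sqrtr_ge0.
Qed.

Lemma opnorm_lb (S : Fun -> Fun) f : L2 f -> sqnorm f <= 1 ->
  (cnorm 2%:E (S f) <= opnorm S)%E.
Proof.
move=> Hf f1; apply: ereal_sup_ubound; exists f => //; split=> //.
by rewrite cnorm2_sqrt // lee_fin -sqrtr1 ler_wsqrtr.
Qed.

Lemma opnorm_ge0 (S : Fun -> Fun) : (0 <= opnorm S)%E.
Proof.
apply: le_trans (@opnorm_lb S (cst 0) (L2_cst 0) _); first exact: Lnorm_ge0.
by rewrite -lecR -cdotff cdot0l ler01.
Qed.

Lemma opnorm_Sop_ub a b : Linf a -> Linf b ->
  (opnorm (Sop a b) <= (Num.sqrt (norm_inf a ^+ 2 + norm_inf b ^+ 2))%:E)%E.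
Proof.
move=> Ha Hb; apply: opnorm_ub => [|f Hf]; first exact: sqrtr_ge0.
split; first exact: L2_Sop.
by rewrite sqr_sqrtr ?addr_ge0 ?sqr_ge0 //; exact: sqnorm_Sop_le.
Qed.

(** The norm is recovered as a real number K, so that the lower estimates can be carried out in
    R. *)
Lemma opnorm_Sop_fin a b : Linf a -> Linf b ->
  exists2 K : R, 0 <= K & opnorm (Sop a b) = K%:E.
Proof.
move=> Ha Hb; have := opnorm_Sop_ub Ha Hb; have := opnorm_ge0 (Sop a b).
by case: (opnorm _) => [K|//|//]; rewrite lee_fin; exists K.
Qed.

(* Any splitting of [h + g] differs from [(h, g)] by an element of the
   intersection of H^2 and its orthogonal complement, which is null. *)
Lemma sqnorm_Sop a b h g : Linf a -> Linf b -> H2 h -> H2perp g ->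
  sqnorm (Sop a b (h + g)) = sqnorm (a * h + b * g).
Proof.
move=> Ha Hb Hh Hg.
have [HP Hd] : H2 (projP (h + g)) /\ H2perp (h + g - projP (h + g)).
  rewrite /projP; case: xgetP => [k -> //|/(_ h) []].
  by split=> //; rewrite addrAC subrr add0r.
set p := projP _ in HP Hd; pose d := p - h.
have Hd1 : H2 d by exact: H2B.
have Hd2 : H2perp d.
  have := H2perpB Hg Hd; rewrite (_ : _ - _ = d) //.
  by apply/funext => z; rewrite /d !fctE; ring.
have d0 : sqnorm d = 0.
  by have /eqP := cdotff d; case: Hd2 => _ -> //; rewrite eq_complex /= => /andP[/eqP].
have Hab := LinfB Ha Hb.
rewrite SopE (_ : _ + _ = (a * h + b * g) + (a - b) * d); last first.
  by apply/funext => z; rewrite /projQ -/p /d !fctE; ring.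
have HL : L2 (a * h + b * g) by apply: L2D; apply: L2_LinfM => //; auto.
have Hd3 : L2 ((a - b) * d) by apply: L2_LinfM => //; exact: H2_L2.
rewrite sqnorm_null //; apply/eqP; rewrite eq_le sqnorm_ge0 andbT.
by apply: le_trans (sqnorm_LinfM Hab (H2_L2 Hd1)) _; rewrite d0 mulr0.
Qed.

(** All lower bounds go through this form. Scaling h + g to norm 1 makes it admissible in the
    supremum, and |h + g|^2 = |h|^2 + |g|^2 by orthogonality. *)
Lemma sqnorm_le_opnorm a b (K : R) h g : Linf a -> Linf b -> 0 <= K ->
  opnorm (Sop a b) = K%:E -> H2 h -> H2perp g ->
  sqnorm (a * h + b * g) <= K ^+ 2 * (sqnorm h + sqnorm g).
Proof.
move=> Ha Hb K0 SK Hh Hg.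
have HL h' g' : H2 h' -> H2perp g' -> L2 (a * h' + b * g').
  by move=> ? ?; apply: L2D; apply: L2_LinfM => //; auto.
have := addr_ge0 (sqnorm_ge0 h) (sqnorm_ge0 g); rewrite le_eqVlt => /predU1P[s0|s0].
  (* If h and g are both null, scaling is impossible, but then a h and b g are null as well. *)
  rewrite -s0 mulr0; move/eqP: s0; rewrite eq_sym paddr_eq0 ?sqnorm_ge0 // => /andP[/eqP h0 /eqP g0].
  have Hah : L2 (a * h) by apply: L2_LinfM => //; auto.
  have Hbg : L2 (b * g) by apply: L2_LinfM => //; auto.
  have := sqnorm_LinfM Hb (H2perp_L2 Hg); rewrite g0 mulr0 => gb.
  rewrite sqnorm_null //; last by apply/eqP; rewrite eq_le gb sqnorm_ge0.
  by apply: le_trans (sqnorm_LinfM Ha (H2_L2 Hh)) _; rewrite h0 mulr0.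
set s := sqnorm h + sqnorm g in s0 *.
pose c : R := (Num.sqrt s)^-1.
have c2 : c ^+ 2 = s^-1 by rewrite exprVn sqr_sqrtr // ltW.
have sc : sqmod c%:C = s^-1 by rewrite /sqmod /= expr0n addr0.
pose h' z := c%:C * h z; pose g' z := c%:C * g z.
have Hh' : H2 h' by exact: H2Z.
have Hg' : H2perp g' by exact: H2perpZ.
have Hf : L2 (h' + g') by apply: L2D; auto.
have f1 : sqnorm (h' + g') = 1.
  rewrite sqnormD; [|by auto|by auto].
  rewrite (cdotC (H2perp_L2 Hg') (H2_L2 Hh')) (Hg'.2 _ Hh') rmorph0 mulr0 addr0.
  by rewrite !sqnormZ ?sc; [rewrite -mulrDr mulVf ?gt_eqF|auto..].
have := opnorm_lb (Sop a b) Hf; rewrite f1 SK => /(_ (lexx _)).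
rewrite cnorm2_sqrt; last exact: L2_Sop.
rewrite sqnorm_Sop // (_ : a * h' + b * g' = (fun z => c%:C * (a * h + b * g) z)); last first.
  by apply/funext => z; rewrite /h' /g' !fctE; ring.
rewrite sqnormZ ?sc; last exact: HL.
rewrite lee_fin => h1.
rewrite -ler_pdivrMr // mulrC -(@sqr_sqrtr _ (_ * _)); last by rewrite mulr_ge0 ?sqnorm_ge0 // invr_ge0 ltW.
by rewrite lerXn2r ?nnegrE ?sqrtr_ge0.
Qed.

End SingularIntegralOperator.

(** * Density of trigonometric polynomials *)

Section Orthonormality.
Variable R : realType.
Local Notation T := (circle R).
Local Notation mu := (circle_measure R).
Local Notation C := R[i].
Local Notation Re := complex.Re.
Local Notation Im := complex.Im.

Lemma expi_exp (t : R) (n : nat) :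
  (expi t : C) ^+ n = cos (t *+ n) +i* sin (t *+ n).
Proof.
elim: n => [|n IH]; first by rewrite expr0 mulr0n cos0 sin0.
rewrite exprS IH mulrS cosD sinD /=; apply/eqP; rewrite eq_complex /=.
by rewrite eqxx /= addrC.
Qed.

(** The integral is pulled back along [expi] to [0, 2 pi], where F is a primitive; nonnegativity of
    u gives access to the change of variables without an integrability check. *)
Lemma int_circle_FTC (u : T -> R) (f F : R -> R) :
  measurable_fun setT u -> (forall z, 0 <= u z) -> (forall t, u (expi t) = f t) ->
  continuous f -> (forall t : R, is_derive t (1 : R) F (f t)) ->
  \int[mu]_z u z = (2 * pi)^-1 * (F (2 * pi) - F 0).
Proof.
move=> mu_ u0 uf cf dF; rewrite /Rintegral.
rewrite ge0_integral_distribution //=; [|exact/measurable_EFinP].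
have mue : measurable_fun setT (fun t : measurableTypeR R => (u (expi t))%:E).
  by apply/measurable_EFinP; apply: (measurableT_comp mu_); exact: measurable_expi.
rewrite integral_uniform //=; [|by move=> t; rewrite lee_fin].
under eq_integral do rewrite uf.
rewrite (@continuous_FTC2 R f F); first by rewrite subr0.
- exact: twopi_gt0.
- exact: continuous_subspaceT.
- have cF t : {for t, continuous F} by apply/differentiable_continuous/derivable1_diffP; case: (dF t).
  split=> [t _||]; first by case: (dF t).
  + by apply: cvg_at_right_filter; exact: cF.
  + by apply: cvg_at_left_filter; exact: cF.
- by move=> t _; rewrite derive1E; case: (dF t).
Qed.

(** Adding 1 makes the integrand nonnegative, as [int_circle_FTC] asks. The phase c covers the
    cosine and the sine at once. *)
Lemma int_circle_cos (u : T -> R) (n : nat) (c : R) : (0 < n)%N ->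
  mu.-integrable setT (EFin \o u) ->
  (forall t, u (expi t) = cos (n%:R * t + c)) -> (forall z, - 1 <= u z) ->
  \int[mu]_z u z = 0.
Proof.
move=> n0 iu uc u1; have nR : n%:R != 0 :> R by rewrite pnatr_eq0 -lt0n.
have i1u : \int[mu]_z (1 + u z) = 1.
  pose f t : R := 1 + cos (n%:R * t + c).
  pose F t : R := t + n%:R^-1 * sin (n%:R * t + c).
  have m1u : measurable_fun setT (fun z => 1 + u z) by exact/measurable_funD/(Rintegrable_measurable iu).
  have u0 z : 0 <= 1 + u z by rewrite addrC -lerBlDr sub0r.
  have uf t : 1 + u (expi t) = f t by rewrite uc.
  have cf : continuous f.
    move=> t; apply: cvgD; first exact: cvg_cst.
    apply: continuous_comp; last exact: continuous_cos.
    by apply: cvgD; [apply: cvgM; [exact: cvg_cst|exact: cvg_id]|exact: cvg_cst].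
  have dF (t : R) : is_derive t (1 : R) F (f t).
    have dl : is_derive t (1 : R) (fun t : R => n%:R * t + c) n%:R.
      by apply: is_derive_eq; rewrite /GRing.scale /= addr0 mulr1.
    have ds := @is_derive1_comp R sin (fun t => n%:R * t + c) t _ _ (is_derive_sin _) dl.
    rewrite (_ : f t = 1 + n%:R^-1 *: (cos (n%:R * t + c) * n%:R)); last first.
      by rewrite /f /GRing.scale /= mulrCA mulVf ?mulr1.
    by have := is_deriveD (is_derive_id t (1 : R)) (is_deriveZ n%:R^-1 ds).
  (* By periodicity the sine terms of F at 0 and 2 pi cancel, leaving the length 2 pi. *)
  have per (k : nat) : sin (k%:R * (2 * pi) + c) = sin c.
    elim: k => [|k IH]; first by rewrite mul0r add0r.
    by rewrite -IH -[RHS]sinD2pi -natr1 mulrDl mul1r -(mulr_natl pi) addrAC.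
  rewrite (int_circle_FTC m1u u0 uf cf dF) /F per mulr0 add0r add0r addrK mulVf //.
  by rewrite mulf_neq0 ?pnatr_eq0 // gt_eqF // pi_gt0.
move: i1u; rewrite circle_intD //; last exact: Rintegrable_cst.
rewrite Rintegral_cst // [X in fine X]probability_setT mul1r /=.
by move/(canRL (addKr _)); rewrite addNr.
Qed.

Lemma Re_le1 (w : C) : sqmod w = 1 -> - 1 <= Re w.
Proof. by case: w => a b; rewrite /sqmod /=; nra. Qed.

Lemma cintegral_expz (n : int) : cintegral (fun z : T => (z : C) ^ n) = (n == 0)%:R.
Proof.
have pos (m : nat) : (0 < m)%N -> cintegral (fun z : T => (z : C) ^+ m) = 0.
  move=> m0; have [i1 i2] : mu.-integrable setT (EFin \o (fun z : T => Re ((z : C) ^+ m))) /\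
      mu.-integrable setT (EFin \o (fun z : T => Im ((z : C) ^+ m))).
    have := L2_expz R m; have := L2_cst (1 : C); move=> H1 Hm.
    split; [have := Rintegrable_Re_dot Hm H1|have := Rintegrable_Im_dot Hm H1]; apply: eq_Rintegrable => z;
      by rewrite [X in _ * X]rmorph1 mulr1.
  rewrite /cintegral; congr Complex.
    apply: (@int_circle_cos _ m 0) => // [t|z].
      by rewrite expi_exp /= addr0 mulr_natl.
    exact/Re_le1/(sqmod_expz z m).
  (* A phase of - pi / 2 turns the cosine into a sine. *)
  apply: (@int_circle_cos _ m (- (pi / 2))) => // [t|z].
    by rewrite expi_exp /= cosBpihalf mulr_natl.
  have := sqmod_expz z m; rewrite -[_ ^ _]/(_ ^+ _).
  by case: (_ ^+ _) => a b; rewrite /sqmod /=; nra.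
have [->|n0] := eqVneq n 0.
  rewrite /cintegral; congr Complex => /=.
    by rewrite Rintegral_cst // [X in fine X]probability_setT mul1r.
  by rewrite Rintegral_cst // mul0r.
case: n n0 => m m0; first by rewrite [LHS]pos // lt0n; move: m0.
(* [Negz m] is - (m + 1), and the integral is <1, z^(m+1)>, the conjugate of a case already
   treated. *)
rewrite (_ : cintegral _ = cdot (cst 1) (fun z : T => (z : C) ^ m.+1)); last first.
  by rewrite /cdot; congr cintegral; apply/funext => z; rewrite mul1r conj_expz NegzE.
rewrite (cdotC (L2_expz R m.+1) (L2_cst 1)) (_ : cdot _ _ = 0) ?rmorph0 //.
rewrite -(pos m.+1) // /cdot; congr cintegral; apply/funext => z.
by rewrite [X in _ * X]rmorph1 mulr1.
Qed.

End Orthonormality.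

(** * Trigonometric polynomials and their closure in L^2 *)

Section TrigonometricPolynomials.
Variable R : realType.
Local Notation T := (circle R).
Local Notation mu := (circle_measure R).
Local Notation C := R[i].
Local Notation Fun := (T -> C).
Local Notation Re := complex.Re.
Local Notation Im := complex.Im.
Implicit Types (f g p q : Fun) (P Q : {poly C}).

(** Boundedness is stable under products, unlike square integrability. *)
Definition bounded_meas f := cmeasurable f /\ exists K, forall z, sqmod (f z) <= K.

Lemma bounded_measD f g : bounded_meas f -> bounded_meas g -> bounded_meas (f + g).
Proof.
move=> [mf [K fK]] [mg [L gL]]; split; first exact: cmeasD.
exists (2 * (K + L)) => z; apply: le_trans (sqmodD_le _ _) _.
by rewrite ler_pM2l // lerD.
Qed.

Lemma bounded_measM f g : bounded_meas f -> bounded_meas g -> bounded_meas (f * g).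
Proof.
move=> [mf [K fK]] [mg [L gL]]; split; first exact: cmeasM.
by exists (K * L) => z; rewrite sqmodM ler_pM // sqmod_ge0.
Qed.

Lemma bounded_meas_cst (c : C) : bounded_meas (cst c).
Proof. by split; [exact: cmeas_cst | exists (sqmod c)]. Qed.

Lemma bounded_meas_expz (n : int) : bounded_meas (fun z : T => (z : C) ^ n).
Proof. by split; [exact: cmeas_expz | exists 1 => z; rewrite sqmod_expz]. Qed.

Lemma bounded_meas_L2 f : bounded_meas f -> L2 f.
Proof. by move=> [mf [K fK]]; exact: L2_bounded fK. Qed.

(** A trigonometric polynomial is stored as one negative power of z times an ordinary polynomial, so
    that multiplying by z^N brings it into H^2. *)
Definition ptrig (N : nat) P : Fun := fun z => (z : C) ^- N * P.[z].
Definition trigpoly f := exists N P, f = ptrig N P.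

Lemma trigpoly_bounded p : trigpoly p -> bounded_meas p.
Proof.
move=> [N [P ->]]; apply: (@bounded_measM (fun z => (z : C) ^- N) (fun z => P.[z])).
  have := bounded_meas_expz (- N%:Z); rewrite (_ : (fun _ => _) = (fun z : T => (z : C) ^- N)) //.
  by apply/funext => z; rewrite exprnN.
elim/poly_ind: P => [|P c IH].
  rewrite (_ : (fun _ => _) = cst 0); first exact: bounded_meas_cst.
  by apply/funext => z; rewrite horner0.
rewrite (_ : (fun _ => _) = (fun z : T => P.[z]) * (fun z : T => (z : C) ^ 1) + cst c).
  by apply: bounded_measD; [apply: bounded_measM => //; exact: bounded_meas_expz | exact: bounded_meas_cst].
by apply/funext => z; rewrite !fctE !hornerE.
Qed.

Lemma trigpoly_L2 p : trigpoly p -> L2 p.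
Proof. by move/trigpoly_bounded/bounded_meas_L2. Qed.

Lemma trigpolyD p q : trigpoly p -> trigpoly q -> trigpoly (p + q).
Proof.
move=> [N [P ->]] [M [Q ->]]; exists (N + M)%N, ('X^M * P + 'X^N * Q).
apply/funext => z; rewrite /ptrig !fctE !hornerE exprD.
have zN : (z : C) ^+ N != 0 by rewrite expf_neq0 // circle_neq0.
have zM : (z : C) ^+ M != 0 by rewrite expf_neq0 // circle_neq0.
move: (_ ^+ N) (_ ^+ M) (P.[_]) (Q.[_]) zN zM => x y u v x0 y0.
by field; rewrite y0 x0.
Qed.

Lemma trigpolyM p q : trigpoly p -> trigpoly q -> trigpoly (p * q).
Proof.
move=> [N [P ->]] [M [Q ->]]; exists (N + M)%N, (P * Q).
by apply/funext => z; rewrite /ptrig !fctE hornerM exprD invfM mulrACA.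
Qed.

Lemma trigpoly_cst (c : C) : trigpoly (cst c).
Proof. by exists 0%N, c%:P; apply/funext => z; rewrite /ptrig expr0 invr1 mul1r hornerC. Qed.

(** On the circle the conjugate of z is 1/z, so Re z = (z^2 + 1) / (2 z); likewise Im z = i (1 -
    z^2) / (2 z) gives the next witness. *)
Lemma trigpoly_Re : trigpoly (fun z : T => (Re z)%:C).
Proof.
exists 1%N, (2^-1 *: ('X^2 + 1%:P)); apply/funext => z.
rewrite /ptrig hornerZ hornerD hornerXn hornerC expr1.
have z0 := circle_neq0 z; rewrite ReJ_add (_ : (z : C)^*%C = (z : C)^-1); last exact: conj_circle.
by field.
Qed.

Lemma trigpoly_Im : trigpoly (fun z : T => (Im z)%:C).
Proof.
exists 1%N, ((2^-1 * 'i%C) *: (1%:P - 'X^2)); apply/funext => z.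
rewrite /ptrig hornerZ hornerD hornerN hornerXn hornerC expr1.
have z0 := circle_neq0 z; rewrite ImJ_sub (_ : (z : C)^*%C = (z : C)^-1); last exact: conj_circle.
by move: 'i%C => i; field.
Qed.

(** One half of the parallelogram law. Its factor 2 is why errors are split into quarters below. *)
Lemma sqnormD_le f g : L2 f -> L2 g -> sqnorm (f + g) <= 2 * (sqnorm f + sqnorm g).
Proof.
move=> Hf Hg; have := sqnorm_ge0 (f - g); rewrite sqnormB // sqnormD //; lra.
Qed.

(** The closure of the trigonometric polynomials in L^2. *)
Definition approximable f :=
  L2 f /\ forall e : R, 0 < e -> exists2 p, trigpoly p & sqnorm (f - p) < e.

Lemma approximable_trig p : trigpoly p -> approximable p.
Proof.
move=> Hp; split=> [|e e0]; first exact: trigpoly_L2.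
exists p => //; rewrite subrr (_ : sqnorm 0 = 0) //.
by apply: Rintegral_0 => z; rewrite /sqmod /= expr0n addr0.
Qed.

Lemma approximable_lim f : L2 f ->
  (forall e : R, 0 < e -> exists2 g, approximable g & sqnorm (f - g) < e) -> approximable f.
Proof.
move=> Hf fg; split=> // e e0.
have e40 : 0 < e / 4 by rewrite divr_gt0.
have [g [Hg gp] h1] := fg _ e40; have [p Hp h2] := gp _ e40.
exists p => //; have -> : f - p = (f - g) + (g - p) by rewrite addrA subrK.
have Hp2 := trigpoly_L2 Hp.
apply: le_lt_trans (sqnormD_le (L2B Hf Hg) (L2B Hg Hp2)) _; lra.
Qed.

Lemma approximableD f g : approximable f -> approximable g -> approximable (f + g).
Proof.
move=> [Hf fp] [Hg gp]; split=> [|e e0]; first exact: L2D.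
have e40 : 0 < e / 4 by rewrite divr_gt0.
have [p Hp h1] := fp _ e40; have [q Hq h2] := gp _ e40.
exists (p + q); first exact: trigpolyD.
rewrite opprD addrACA.
apply: le_lt_trans (sqnormD_le (L2B Hf (trigpoly_L2 Hp)) (L2B Hg (trigpoly_L2 Hq))) _; lra.
Qed.

Lemma approximableZ (c : C) f : approximable f -> approximable (fun z => c * f z).
Proof.
move=> [Hf fp]; split=> [|e e0]; first exact: L2Z.
have c0 : 0 < sqmod c + 1 by rewrite ltr_wpDl ?sqmod_ge0.
have [p Hp h] := fp _ (divr_gt0 e0 c0).
exists (cst c * p); first exact/trigpolyM/Hp/trigpoly_cst.
rewrite (_ : _ - _ = (fun z => c * (f - p) z)); last first.
  by apply/funext => z; rewrite !fctE mulrBr.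
rewrite sqnormZ; last exact/L2B/trigpoly_L2.
move: h; rewrite ltr_pdivlMr // mulrC => h; apply: le_lt_trans h.
by rewrite ler_wpM2r ?sqnorm_ge0 // lerDl.
Qed.

Lemma approximable_cst (c : C) : approximable (cst c).
Proof. exact/approximable_trig/trigpoly_cst. Qed.

Lemma approximable_sum (I : Type) (s : seq I) (F : I -> Fun) :
  (forall i, approximable (F i)) -> approximable (\sum_(i <- s) F i).
Proof.
by move=> FA; elim/big_rec: _ => [|i f _ Hf]; [exact: (approximable_cst 0)|exact: approximableD].
Qed.

Lemma sqnorm_dominated (g : nat -> Fun) f (G : T -> R) :
  (forall n, L2 (g n)) -> L2 f -> mu.-integrable setT (EFin \o G) ->
  (forall n z, sqmod (f z - g n z) <= G z) ->
  (forall z, sqmod (f z - g n z) @[n --> \oo] --> (0 : R)) ->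
  sqnorm (f - g n) @[n --> \oo] --> (0 : R).
Proof.
move=> Hg Hf iG gG gf.
have Hd n : L2 (f - g n) by exact: L2B.
have [] := @dominated_convergence _ _ _ mu setT measurableT
  (fun n z => (sqmod ((f - g n) z))%:E) (cst 0%E) (EFin \o G).
- by move=> n; exact/measurable_EFinP/cmeas_sqmod/L2_cmeasurable.
- exact: measurable_cst.
- apply: aeW => z _ /=; apply/cvg_EFin; first exact: nearW.
  by apply: cvg_trans (gf z); apply: near_eq_cvg; apply: nearW.
- exact: iG.
- by apply: aeW => z n _; rewrite abse_EFin ger0_norm ?sqmod_ge0 // lee_fin gG.
by move=> _ _; rewrite integral0 => /fine_cvg h; exact: h.
Qed.

(** The limits in the density proof are taken in this form: pointwise convergence with an integrable
    bound on the squared error. *)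
Lemma approximable_cvg (g : nat -> Fun) f (G : T -> R) :
  (forall n, approximable (g n)) -> L2 f -> mu.-integrable setT (EFin \o G) ->
  (forall n z, sqmod (f z - g n z) <= G z) ->
  (forall z, sqmod (f z - g n z) @[n --> \oo] --> (0 : R)) -> approximable f.
Proof.
move=> Hg Hf iG gG gf; apply: approximable_lim => // e e0.
have /cvgr0Pnorm_lt /(_ e e0) [N _ h] := sqnorm_dominated (fun n => (Hg n).1) Hf iG gG gf.
exists (g N); first exact: Hg.
by have := h N (leqnn N); rewrite ger0_norm // sqnorm_ge0.
Qed.

End TrigonometricPolynomials.

(** * Polynomial iteration converging to the sign function *)

Section SignIteration.
Variable R : realType.
Implicit Types s x : R.

(** The fixed points are -1, 0 and 1. The derivative is 0 at -1 and 1, which attract, and 3/2 at 0,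
    which repels. *)
Definition sign_step s := (3 * s - s ^+ 3) / 2.

Lemma sign_step_bnd s : -1 <= s <= 1 -> -1 <= sign_step s <= 1.
Proof.
move=> /andP[s1 s2]; apply/andP; split; rewrite -subr_ge0 /sign_step.
  rewrite (_ : _ - _ = (1 + s) ^+ 2 * (2 - s) / 2); last by field.
  by rewrite divr_ge0 // mulr_ge0 ?sqr_ge0 //; lra.
rewrite (_ : _ - _ = (1 - s) ^+ 2 * (2 + s) / 2); last by field.
by rewrite divr_ge0 // mulr_ge0 ?sqr_ge0 //; lra.
Qed.

Lemma sign_stepN s : sign_step (- s) = - sign_step s.
Proof. by rewrite /sign_step; field. Qed.

Definition sign_iter n x := iter n sign_step x.

Lemma sign_iter_bnd n x : -1 <= x <= 1 -> -1 <= sign_iter n x <= 1.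
Proof. by move=> hx; elim: n => //= n; exact: sign_step_bnd. Qed.

Lemma sign_iterN n x : sign_iter n (- x) = - sign_iter n x.
Proof. by elim: n => //= n ->; exact: sign_stepN. Qed.

Lemma sign_iter0 n : sign_iter n 0 = 0.
Proof. by elim: n => //= n ->; rewrite /sign_step; field. Qed.

(** The iterates s stay above x, and one step multiplies the distance to 1 by at most 1 - s / 2 <= 1
    - x / 2, hence geometric decay. *)
Lemma sign_iter_pos n x : 0 < x <= 1 ->
  x <= sign_iter n x <= 1 /\ 1 - sign_iter n x <= (1 - x / 2) ^+ n.
Proof.
move=> /andP[x0 x1]; elim: n => [|n [/andP[h1 h2] h3]] /=; first by rewrite lexx expr0 x1; split => //; lra.
move: h1 h2 h3; move: (sign_iter n x) => s h1 h2 h3.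
have s0 : 0 < s by exact: lt_le_trans h1.
have e1 : sign_step s - s = s * (1 - s) * (1 + s) / 2 by rewrite /sign_step; field.
have e2 : (1 - s) * (1 - s / 2) - (1 - sign_step s) = (1 - s) * s ^+ 2 / 2.
  by rewrite /sign_step; field.
have p1 : 0 <= s * (1 - s) * (1 + s) / 2.
  by rewrite divr_ge0 // mulr_ge0 ?mulr_ge0 //; lra.
have p2 : 0 <= (1 - s) * s ^+ 2 / 2.
  by rewrite divr_ge0 // mulr_ge0 ?sqr_ge0 //; lra.
have /andP[_ b] : -1 <= sign_step s <= 1 by apply: sign_step_bnd; lra.
split; first by rewrite b andbT; lra.
rewrite exprSr; apply: (@le_trans _ _ ((1 - s) * (1 - s / 2))); first by lra.
by apply: ler_pM => //; lra.
Qed.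

Lemma sign_iter_cvg1 x : 0 < x <= 1 -> sign_iter n x @[n --> \oo] --> (1 : R).
Proof.
move=> hx; have /andP[x0 x1] := hx.
apply/cvgrPdist_le => e e0.
have : (1 - x / 2) ^+ n @[n --> \oo] --> (0 : R) by apply: cvg_expr; rewrite ger0_norm; lra.
move/cvgr0Pnorm_le => /(_ e e0); apply: filterS => n hn.
have [/andP[_ h1] h2] := sign_iter_pos n hx.
rewrite ger0_norm ?subr_ge0 //; apply: le_trans h2 _.
by apply: le_trans hn; exact: ler_norm.
Qed.

(** The polynomial (s^2 + s) / 2 sends -1, 0, 1 to 0, 0, 1, so the limit is the indicator of the
    open half-line x > 0. *)
Definition heaviside_iter n x := (sign_iter n x ^+ 2 + sign_iter n x) / 2.

Lemma heaviside_iter_bnd n x : -1 <= x <= 1 -> `|heaviside_iter n x| <= 1.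
Proof.
move=> /(sign_iter_bnd n); rewrite /heaviside_iter; move: (sign_iter n x) => s /andP[h1 h2].
by rewrite ler_norml; apply/andP; split; nra.
Qed.

Lemma heaviside_iter_cvg x : -1 <= x <= 1 ->
  heaviside_iter n x @[n --> \oo] --> ((0 < x)%R%:R : R).
Proof.
move=> /andP[x1 x2].
have lim (l : R) : sign_iter n x @[n --> \oo] --> l ->
    heaviside_iter n x @[n --> \oo] --> (l ^+ 2 + l) / 2.
  move=> h; apply: cvgM; last exact: cvg_cst.
  by apply: cvgD => //; rewrite expr2; under eq_fun do rewrite expr2; exact: cvgM.
have [x0|x0|x0] := ltgtP 0 x.
- have /(lim 1) : sign_iter n x @[n --> \oo] --> (1 : R) by apply: sign_iter_cvg1; rewrite x0.
  by rewrite (_ : (_ + _) / _ = 1%:R) //; field.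
- have : - sign_iter n (- x) @[n --> \oo] --> (- 1 : R).
    by apply: cvgN; apply: sign_iter_cvg1; lra.
  under eq_fun do rewrite sign_iterN opprK.
  by move/(lim (-1)); rewrite (_ : (_ + _) / _ = 0%:R) //; field.
- have /(lim 0) : sign_iter n x @[n --> \oo] --> (0 : R).
    by rewrite -x0; under eq_fun do rewrite sign_iter0; exact: cvg_cst.
  by rewrite (_ : (_ + _) / _ = 0%:R) //; field.
Qed.

End SignIteration.

(** * Indicators of quadrants *)

Section Density.
Variable R : realType.
Local Notation T := (circle R).
Local Notation mu := (circle_measure R).
Local Notation C := R[i].
Local Notation Fun := (T -> C).
Local Notation Re := complex.Re.
Local Notation Im := complex.Im.
Implicit Types (f g p q : Fun) (x : T -> R).

Definition cindic (E : set T) : Fun := fun z => (\1_E z)%:C.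

Lemma trigpoly_real_poly x (P : {poly R}) :
  trigpoly (fun z => (x z)%:C) -> trigpoly (fun z => P.[x z]%:C).
Proof.
move=> Hx; elim/poly_ind: P => [|P c IH].
  rewrite (_ : (fun _ => _) = cst 0); first exact: trigpoly_cst.
  by apply/funext => z; rewrite horner0.
rewrite (_ : (fun _ => _) = (fun z => P.[x z]%:C) * (fun z => (x z)%:C) + cst c%:C).
  by apply: trigpolyD; [exact: trigpolyM|exact: trigpoly_cst].
by apply/funext => z; rewrite !fctE hornerMXaddC rmorphD rmorphM.
Qed.

Lemma trigpoly_heaviside n x :
  trigpoly (fun z => (x z)%:C) -> trigpoly (fun z => (heaviside_iter n (x z))%:C).
Proof.
move=> Hx.
have Hs : trigpoly (fun z => (sign_iter n (x z))%:C).
  elim: n => // n IH.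
  have := trigpoly_real_poly (2^-1 *: (3 *: 'X - 'X^3)) IH.
  congr trigpoly; apply/funext => z.
  by rewrite hornerZ hornerD hornerN hornerZ hornerXn hornerX /= /sign_step mulrC.
have := trigpoly_real_poly (2^-1 *: ('X^2 + 'X)) Hs.
congr trigpoly; apply/funext => z.
by rewrite hornerZ hornerD hornerXn hornerX /= mulrC.
Qed.

Lemma sqmod_real (r : R) : sqmod r%:C = r ^+ 2.
Proof. by rewrite /sqmod /= expr0n addr0. Qed.

Lemma L2_real (u : T -> R) : measurable_fun setT u ->
  mu.-integrable setT (EFin \o (fun z => u z ^+ 2)) -> L2 (fun z => (u z)%:C).
Proof.
move=> mu_ iu; apply/L2P; split; first by split=> //; exact: measurable_cst.
by apply: eq_Rintegrable iu => z; rewrite sqmod_real.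
Qed.

Lemma L2_cindic (E : set T) : measurable E -> L2 (cindic E).
Proof.
move=> mE; apply: (@L2_bounded _ 1).
  by split; [exact: measurable_indic|exact: measurable_cst].
by move=> z; rewrite sqmod_real indicE; case: (_ \in _); rewrite ?expr1n ?expr0n.
Qed.

Lemma Re_Im_bnd (z : T) : -1 <= Re z <= 1 /\ -1 <= Im z <= 1.
Proof.
have := sqmod_circle z; rewrite /sqmod; case: (z : C) => a b /= h.
by have := sqr_ge0 a; have := sqr_ge0 b; split; apply/andP; split; nra.
Qed.

(** These sets form a pi-system, and their strict inequalities match the value 0 that the limit of
    [heaviside_iter] takes at 0. *)
Definition quadrants : set (set T) :=
  [set E | exists a b : R, E = [set z : T | a < Re z /\ b < Im z]].

Lemma measurable_circleE : @measurable _ T = <<s quadrants >>.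
Proof.
have mR : measurable_fun setT (fun z : T => Re z) by have [] := cmeas_expz R 1.
have mI : measurable_fun setT (fun z : T => Im z) by have [] := cmeas_expz R 1.
apply/seteqP; split; last first.
  apply: smallest_sub; first exact: sigma_algebra_measurable.
  move=> _ [a [b ->]].
  have := measurableI _ _ (mR measurableT _ (measurable_itv `]a, +oo[))
                          (mI measurableT _ (measurable_itv `]b, +oo[)).
  rewrite !setTI; congr measurable; apply/seteqP; split=> z /=;
    by rewrite !in_itv /= !andbT.
have mc : measurable_fun (setT : set (g_sigma_algebraType quadrants))
    (@circle_coord R : g_sigma_algebraType quadrants -> _).
  apply/measurable_fun_pair.
  - apply: (measurability _ (RGenOInfty.measurableE R)) => _ [_ [a ->] <-].
    (* The bound -2 lies below both coordinates of every point of the circle, so this quadrant is a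
       half-plane. *)
    apply: sub_sigma_algebra; exists a, (-2); rewrite setTI; apply/seteqP; split=> z /=.
      rewrite in_itv /= andbT; split=> //.
      by have [_ /andP[h _]] := Re_Im_bnd z; apply: lt_le_trans h; lra.
    by rewrite in_itv /= andbT => -[].
  - apply: (measurability _ (RGenOInfty.measurableE R)) => _ [_ [a ->] <-].
    apply: sub_sigma_algebra; exists (-2), a; rewrite setTI; apply/seteqP; split=> z /=.
      rewrite in_itv /= andbT; split=> //.
      by have [/andP[h _] _] := Re_Im_bnd z; apply: lt_le_trans h; lra.
    by rewrite in_itv /= andbT => -[].
move=> _ [B mB <-]; exact: (mc measurableT B mB).
Qed.

(** For |x| <= 1, dividing by 1 + |a| brings x - a into [-1, 1], where the iteration converges,
    without changing its sign. *)
Lemma trigpoly_affine x (a : R) : trigpoly (fun z => (x z)%:C) ->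
  trigpoly (fun z => ((x z - a) / (1 + `|a|))%:C).
Proof.
move/(trigpoly_real_poly ((1 + `|a|)^-1 *: ('X - a%:P))).
congr trigpoly; apply/funext => z.
by rewrite hornerZ hornerD hornerN hornerC hornerX mulrC.
Qed.

Lemma affine_bnd (a t : R) : -1 <= t <= 1 -> -1 <= (t - a) / (1 + `|a|) <= 1.
Proof.
move=> /andP[h1 h2]; have a0 := normr_ge0 a; have a1 := ler_norm a.
have a2 : - a <= `|a| by rewrite -normrN ler_norm.
by rewrite ler_pdivlMr ?ler_pdivrMr; [apply/andP; split; lra | lra..].
Qed.

Lemma affine_gt0 (a t : R) : (0 < (t - a) / (1 + `|a|)) = (a < t).
Proof. by rewrite pmulr_lgt0 ?subr_gt0 // invr_gt0 ltr_pwDl. Qed.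

Lemma approximable_quadrant (E : set T) : quadrants E -> approximable (cindic E).
Proof.
move=> qE; have mE : measurable E by rewrite measurable_circleE; exact: sub_sigma_algebra.
case: qE mE => a [b ->] mE.
pose x (z : T) := (Re z - a) / (1 + `|a|); pose y (z : T) := (Im z - b) / (1 + `|b|).
have xb z : -1 <= x z <= 1 by apply: affine_bnd; have [] := Re_Im_bnd z.
have yb z : -1 <= y z <= 1 by apply: affine_bnd; have [] := Re_Im_bnd z.
pose g n : Fun := (fun z => (heaviside_iter n (x z))%:C) * (fun z => (heaviside_iter n (y z))%:C).
have gE n z : g n z = (heaviside_iter n (x z) * heaviside_iter n (y z))%:C.
  by rewrite rmorphM.
(* The indicator and its approximation have modulus at most 1, so the squared error is at most 4. *)
apply: (@approximable_cvg _ g _ (fun=> 4)).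
- move=> n; apply/approximable_trig/trigpolyM; apply: trigpoly_heaviside.
    exact/trigpoly_affine/trigpoly_Re.
  exact/trigpoly_affine/trigpoly_Im.
- exact: L2_cindic.
- exact: Rintegrable_cst.
- move=> n z; rewrite gE -rmorphB sqmod_real.
  have : `|heaviside_iter n (x z) * heaviside_iter n (y z)| <= 1.
    by rewrite normrM mulr_ile1 // heaviside_iter_bnd.
  rewrite ler_norml indicE; move: (_ * _) => t /andP[h1 h2].
  by case: (_ \in _) => /=; nra.
- move=> z; under eq_fun do rewrite gE -rmorphB sqmod_real.
  have -> : \1_[set z0 : T | a < Re z0 /\ b < Im z0] z = (0 < x z)%R%:R * (0 < y z)%R%:R :> R.
    rewrite !affine_gt0 -natrM mulnb indicE; congr (_%:R : R); congr nat_of_bool.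
    by apply/idP/andP; rewrite inE.
  set l := _ * _.
  have h : l - heaviside_iter n (x z) * heaviside_iter n (y z) @[n --> \oo] --> (0 : R).
    rewrite -(subrr l); apply: cvgB; first exact: cvg_cst.
    by apply: cvgM; exact: heaviside_iter_cvg.
  under eq_fun do rewrite expr2.
  by rewrite -(mulr0 (0 : R)); exact: cvgM.
Qed.

End Density.

(** * From quadrants to Borel sets, simple functions and all of L^2 *)

Section DensityL2.
Variable R : realType.
Local Notation T := (circle R).
Local Notation mu := (circle_measure R).
Local Notation C := R[i].
Local Notation Fun := (T -> C).
Local Notation Re := complex.Re.
Local Notation Im := complex.Im.
Implicit Types (f g p q : Fun).

Lemma quadrantsI : setI_closed (@quadrants R).
Proof.
move=> _ _ [a [b ->]] [c [d ->]]; exists (Num.max a c), (Num.max b d).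
apply/seteqP; split=> z /=; rewrite !gt_max.
  by move=> [[-> ->] [-> ->]].
by move=> [/andP[-> ->] /andP[-> ->]].
Qed.

Lemma approximable_cindic (E : set T) : measurable E -> approximable (cindic E).
Proof.
rewrite measurable_circleE; move: E.
apply: (@dynkin_induction _ _ _ (fun E => approximable (cindic E)) (measurable_circleE R)
  quadrantsI).
- rewrite (_ : cindic _ = cst 1); first exact: approximable_cst.
  by apply/funext => z; rewrite /cindic indicT.
- exact: approximable_quadrant.
- move=> E mE HE.
  rewrite (_ : cindic _ = cst 1 + (fun z => -1 * cindic E z)).
    exact/approximableD/approximableZ/HE/approximable_cst.
  apply/funext => z; rewrite !fctE /cindic !indicE in_setC.
  by case: (z \in E); rewrite /= ?rmorph0 ?rmorph1 ?mulr1 ?mulr0 ?addr0 ?subrr.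
- move=> F mF tF HF.
  (* Finite partial unions are handled by additivity, as the sets are disjoint; their indicators
     converge to that of the whole union. *)
  pose U n := \bigcup_(k < n) F k.
  have mU n : measurable (U n) by apply: bigcup_measurable => k _; exact: mF.
  have HU n : approximable (cindic (U n)).
    elim: n => [|n IH].
      rewrite (_ : cindic _ = cst 0); first exact: approximable_cst.
      by apply/funext => z; rewrite /cindic /U bigcup_mkord big_ord0 indic0.
    rewrite (_ : cindic _ = cindic (U n) + cindic (F n)); first exact: approximableD.
    apply/funext => z; rewrite !fctE /cindic -rmorphD /=; congr (_%:C).
    rewrite !indicE; have [zF|zF] := boolP (z \in F n).
      rewrite (_ : (z \in U n.+1) = true); last first.
        by apply/mem_set; exists n => //=; exact/set_mem.
      rewrite (_ : (z \in U n) = false) ?add0r //.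
      apply/negbTE/negP => /set_mem[k /= kn Fk].
      have := (trivIsetP.1 tF) k n I I; rewrite neq_ltn kn => /(_ erefl) h.
      suff : set0 z by []. 
      by rewrite -h; split=> //; exact/set_mem.
    rewrite addr0; congr (nat_of_bool _)%:R; apply/idP/idP => /set_mem[k /= kn Fk]; apply/mem_set.
      exists k => //=; move: kn; rewrite ltnS leq_eqVlt => /predU1P[kn|//].
      by move: zF; rewrite -kn (mem_set Fk).
    by exists k => //=; rewrite ltnS ltnW.
  apply: (@approximable_cvg _ (fun n => cindic (U n)) _ (fun=> 1)).
  + exact: HU.
  + by apply: L2_cindic; apply: bigcup_measurable => k _; exact: mF.
  + exact: Rintegrable_cst.
  + move=> n z; rewrite -rmorphB sqmod_real !indicE.
    by case: (_ \in _); case: (_ \in _); rewrite ?subrr ?subr0 ?sub0r ?sqrrN ?expr0n ?expr1n.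
  + move=> z; have [[k _ Fk]|nF] := pselect ((\bigcup_k F k) z).
      apply: (@cvg_trans _ ((0 : R) @[n --> \oo])); last exact: cvg_cst.
      (* Once n > k, z lies in [U n] too and the error is exactly 0. *)
      apply: near_eq_cvg; exists k.+1 => // n /= kn.
      rewrite -rmorphB sqmod_real !indicE !mem_set ?subrr ?expr0n //; last by exists k.
      by exists k.
    apply: (@cvg_trans _ ((0 : R) @[n --> \oo])); last exact: cvg_cst.
    apply: near_eq_cvg; apply: nearW => n.
    rewrite -rmorphB sqmod_real !indicE !memNset ?subrr ?expr0n //.
    by move=> [k _ Fk]; apply: nF; exists k.
Qed.

Import HBNNSimple.

Lemma approximable_nnsfun (u : {nnsfun T >-> R}) : approximable (fun z => (u z)%:C).
Proof.
rewrite (_ : (fun _ => _) =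
  \sum_(y <- finmap.enum_fset (fset_set (range u))) (fun z => y%:C * cindic (u @^-1` [set y]) z)).
  apply: approximable_sum => y; apply: approximableZ; apply: approximable_cindic.
  by rewrite -[X in measurable X]setTI; exact: (measurable_funPT u).
apply/funext => z; rewrite fimfunE fsbig_finite //= rmorph_sum fct_sumE /=.
by apply: eq_bigr => y _; rewrite rmorphM.
Qed.

(** Simple functions g n increase to u; from 0 <= g n <= u the squared error is dominated by the
    integrable u^2. *)
Lemma approximable_nonneg (u : T -> R) : measurable_fun setT u -> (forall z, 0 <= u z) ->
  mu.-integrable setT (EFin \o (fun z => u z ^+ 2)) -> approximable (fun z => (u z)%:C).
Proof.
move=> mu_ u0 iu.
have mue : measurable_fun setT (EFin \o u) by exact/measurable_EFinP.
have ue0 z : setT z -> (0 <= (EFin \o u) z)%E by rewrite /= lee_fin.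
pose g n := nnsfun_approx measurableT mue n.
have gu n z : 0 <= g n z <= u z.
  apply/andP; split; first exact: fun_ge0.
  by rewrite /g nnsfun_approxE -lee_fin; exact: le_approx.
have gc z : g n z @[n --> \oo] --> u z.
  by have /fine_cvg := cvg_nnsfun_approx measurableT mue ue0 (I : setT z).
apply: (@approximable_cvg _ (fun n z => (g n z)%:C) _ (fun z => u z ^+ 2)) => //.
- by move=> n; exact: approximable_nnsfun.
- exact: L2_real.
- move=> n z; rewrite -rmorphB sqmod_real.
  by have /andP[h1 h2] := gu n z; rewrite lerXn2r ?nnegrE ?subr_ge0 // gerBl.
- move=> z; under eq_fun do rewrite -rmorphB sqmod_real expr2.
  have h : u z - g n z @[n --> \oo] --> (0 : R).
    by rewrite -(subrr (u z)); apply: cvgB; [exact: cvg_cst|exact: gc].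
  by rewrite -(mulr0 (0 : R)); exact: cvgM.
Qed.

Lemma approximable_real (u : T -> R) : measurable_fun setT u ->
  mu.-integrable setT (EFin \o (fun z => u z ^+ 2)) -> approximable (fun z => (u z)%:C).
Proof.
move=> mu_ iu.
(* Serves for both parts: w is u for the positive part and - u for the negative part. *)
have half (v w : T -> R) : measurable_fun setT v -> (forall z, v z = Num.max (w z) 0) ->
    (forall z, w z ^+ 2 = u z ^+ 2) -> approximable (fun z => (v z)%:C).
  move=> mv vw wu; apply: approximable_nonneg => //.
    by move=> z; rewrite vw le_max lexx orbT.
  apply: Rintegrable_le iu; first exact: measurable_funX.
  move=> z; rewrite -wu vw ger0_norm ?sqr_ge0 //.
  by case: (leP (w z) 0) => _; rewrite ?expr0n /= ?sqr_ge0.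
rewrite (_ : (fun z : T => (u z)%:C) = (fun z => (u^\+ z)%:C) + (fun z => -1 * (u^\- z)%:C)); last first.
  by apply/funext => z; rewrite !fctE mulN1r -rmorphB -[in LHS](funrposBneg u).
apply: approximableD; [|apply: approximableZ].
  by apply: (half _ u) => //; exact: measurable_funrpos.
by apply: (half _ (\- u)) => [|//|z]; [exact: measurable_funrneg|rewrite /= sqrrN].
Qed.

Lemma L2_approximable f : L2 f -> approximable f.
Proof.
move=> /L2P[[mR mI] fi].
rewrite (_ : f = (fun z => (Re (f z))%:C) + (fun z => 'i%C * (Im (f z))%:C)); last first.
  by apply/funext => z; rewrite !fctE -complexE.
apply: approximableD; [|apply: approximableZ]; apply: approximable_real => //.
- apply: Rintegrable_le fi; first exact: measurable_funX.
  by move=> z; rewrite ger0_norm ?sqr_ge0 // lerDl sqr_ge0.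
- apply: Rintegrable_le fi; first exact: measurable_funX.
  by move=> z; rewrite ger0_norm ?sqr_ge0 // lerDr sqr_ge0.
Qed.

End DensityL2.

(** * Lower bounds and norm formulas *)

Section OperatorNorm.
Variable R : realType.
Local Notation T := (circle R).
Local Notation mu := (circle_measure R).
Local Notation C := R[i].
Local Notation Fun := (T -> C).
Local Notation Re := complex.Re.
Local Notation Im := complex.Im.
Implicit Types (a b f g h p q : Fun) (P : {poly C}).
#[local] Hint Resolve H2_L2 H2perp_L2 : core.

Lemma cdot_expz (m n : int) :
  cdot (fun z : T => (z : C) ^ m) (fun z => (z : C) ^ n) = (m == n)%:R.
Proof.
rewrite -subr_eq0 -cintegral_expz /cdot; congr cintegral; apply/funext => z.
by rewrite conj_expz -expfzDr // circle_neq0.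
Qed.

Lemma sqnorm_expz (n : int) : sqnorm (fun z : T => (z : C) ^ n) = 1.
Proof. by apply: (@complexI R); rewrite -cdotff cdot_expz eqxx. Qed.

Lemma H2_expz (m : nat) : H2 (fun z : T => (z : C) ^ m).
Proof.
split=> [|n n0]; first exact: L2_expz.
by rewrite /fourier cdot_expz; case: eqP => // mn; move: n0; rewrite -mn.
Qed.

(** <z^m, h> is the conjugate of the Fourier coefficient of h at m < 0. *)
Lemma H2perp_expz (m : int) : m < 0 -> H2perp (fun z : T => (z : C) ^ m).
Proof.
move=> m0; split=> [|h [Hh h0]]; first exact: L2_expz.
by rewrite (cdotC Hh (L2_expz _ m)) -/(fourier h m) h0 ?rmorph0.
Qed.

Lemma H2D f g : H2 f -> H2 g -> H2 (f + g).
Proof.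
move=> Hf /(H2Z (-1)) Hg; have := H2B Hf Hg; congr H2.
by apply/funext => z; rewrite !fctE mulN1r opprK.
Qed.

Lemma H2perpD f g : H2perp f -> H2perp g -> H2perp (f + g).
Proof.
move=> Hf /(H2perpZ (-1)) Hg; have := H2perpB Hf Hg; congr H2perp.
by apply/funext => z; rewrite !fctE mulN1r opprK.
Qed.

Lemma H2perp_0 : H2perp (cst 0 : Fun).
Proof. by split=> [|h _]; [exact: L2_cst | exact: cdot0l]. Qed.

Lemma H2_poly P : H2 (fun z : T => P.[z]).
Proof.
rewrite (_ : (fun _ => _) = \sum_(i < size P) (fun z : T => P`_i * (z : C) ^ i)).
  elim/big_rec: _ => [|i f _ Hf]; first exact: H2_0.
  exact/H2D/Hf/H2Z/H2_expz.
by apply/funext => z; rewrite horner_coef fct_sumE.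
Qed.

(** Every exponent i - N that occurs is negative, since i < [size P] <= N. *)
Lemma H2perp_ptrig P N : (size P <= N)%N -> H2perp (@ptrig R N P).
Proof.
move=> PN; rewrite (_ : ptrig _ _ = \sum_(i < size P) (fun z : T => P`_i * (z : C) ^ (i%:Z - N%:Z))).
  elim/big_rec: _ => [|i f _ Hf]; first exact: H2perp_0.
  apply/H2perpD/Hf/H2perpZ/H2perp_expz.
  by rewrite subr_lt0 ltz_nat (leq_trans (ltn_ord i)).
apply/funext => z; rewrite /ptrig horner_coef fct_sumE mulr_sumr.
by apply: eq_bigr => i _; rewrite expfzDr ?circle_neq0 // -exprnN mulrCA [(z : C) ^- N * _]mulrC.
Qed.

(** Since |z| = 1, shifting frequencies changes no norm. This is what carries an arbitrary
    trigonometric polynomial into H^2 or into its complement. *)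
Lemma sqnorm_ptrigM a N P : sqnorm (a * ptrig N P) = sqnorm (a * (fun z => P.[z])).
Proof.
apply: eq_Rintegral => z _; rewrite /ptrig !fctE !sqmodM.
by rewrite (_ : sqmod ((z : C) ^- N) = 1) ?mul1r //; have := sqmod_expz z (- N%:Z); rewrite -exprnN.
Qed.

Lemma sqnorm_ptrig N P : sqnorm (@ptrig R N P) = sqnorm (fun z : T => P.[z]).
Proof.
apply: eq_Rintegral => z _; rewrite /ptrig sqmodM.
by rewrite (_ : sqmod ((z : C) ^- N) = 1) ?mul1r //; have := sqmod_expz z (- N%:Z); rewrite -exprnN.
Qed.

Lemma sqnorm_0 : sqnorm (cst 0 : Fun) = 0.
Proof. by apply: Rintegral_0 => z; rewrite /sqmod /= expr0n addr0. Qed.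

Lemma mul_bound_density a (K : R) : Linf a -> 0 <= K ->
  (forall p, trigpoly p -> sqnorm (a * p) <= K ^+ 2 * sqnorm p) ->
  forall f, L2 f -> sqnorm (a * f) <= K ^+ 2 * sqnorm f.
Proof.
move=> Ha K0 Hp f Hf.
suff h : Num.sqrt (sqnorm (a * f)) <= K * Num.sqrt (sqnorm f).
  rewrite -(sqr_sqrtr (sqnorm_ge0 f)) -(sqr_sqrtr (sqnorm_ge0 (a * f))) -exprMn.
  by rewrite lerXn2r ?nnegrE ?mulr_ge0 ?sqrtr_ge0.
apply/ler_addgt0Pr => e e0; set A := norm_inf a.
have A0 : 0 <= A by exact: norm_inf_ge0.
(* Approximating f within d costs K d + A d in total; the added 1 keeps the divisor positive. *)
have c0 : 0 < K + A + 1 by lra.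
have d0 := divr_gt0 e0 c0; set d := e / _ in d0.
have dE : (K + A + 1) * d = e by rewrite mulrC divfK // gt_eqF.
have [_ /(_ _ (exprn_gt0 2 d0)) [p tp fp]] := L2_approximable Hf.
have Hp2 := trigpoly_L2 tp; have Hfp := L2B Hf Hp2.
have {fp}fp : Num.sqrt (sqnorm (f - p)) <= d.
  by rewrite -[d]ger0_norm ?(ltW d0) // -sqrtr_sqr ler_wsqrtr // ltW.
have h1 : Num.sqrt (sqnorm (a * f)) <= Num.sqrt (sqnorm (a * p)) + Num.sqrt (sqnorm (a * (f - p))).
  rewrite (_ : a * f = a * p + a * (f - p)); last by rewrite -mulrDr addrC subrK.
  by apply: sqnorm_triangle; exact: L2_LinfM.
have h2 := sqrt_le_scaled A0 (sqnorm_LinfM Ha Hfp).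
have h3 := sqrt_le_scaled K0 (Hp _ tp).
have h4 : Num.sqrt (sqnorm p) <= Num.sqrt (sqnorm f) + Num.sqrt (sqnorm (f - p)).
  rewrite -(sqnormN (f - p)) {1}(_ : p = f + - (f - p)); last by rewrite opprB addrC subrK.
  exact/sqnorm_triangle/L2N.
have h5 : A * Num.sqrt (sqnorm (f - p)) <= A * d by rewrite ler_wpM2l.
have h6 : K * Num.sqrt (sqnorm p) <= K * (Num.sqrt (sqnorm f) + d).
  by rewrite ler_wpM2l // (le_trans h4) // lerD2l.
have h7 : (K + A + 1) * d = K * d + A * d + d by ring.
rewrite mulrDr in h6; lra.
Qed.

(** Tested on the indicator of E = {|a| > K}, the hypothesis makes the integral of (|a|^2 - K^2) 1_E
    at most 0. The integrand is nonnegative, and positive on E, so E is null. *)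
Lemma norm_inf_le_mul a (K : R) : Linf a -> 0 <= K ->
  (forall f, L2 f -> sqnorm (a * f) <= K ^+ 2 * sqnorm f) -> norm_inf a <= K.
Proof.
move=> Ha K0 aK; have ma : cmeasurable a by case: Ha.
have ms := cmeas_sqmod ma.
pose E := [set z : T | K ^+ 2 < sqmod (a z)].
have mE : measurable E.
  have := ms measurableT _ (measurable_itv `]K ^+ 2, +oo[).
  by rewrite setTI; congr measurable; apply/seteqP; split=> z /=; rewrite in_itv /= andbT.
have HE := L2_cindic mE; have HaE := L2_LinfM Ha HE.
pose u z := sqmod ((a * cindic E) z) - K ^+ 2 * sqmod (cindic E z).
have iu : mu.-integrable setT (EFin \o u).
  by apply: RintegrableB; [exact: L2_Rintegrable|apply/RintegrableZ/L2_Rintegrable].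
have uE z : u z = (sqmod (a z) - K ^+ 2) * \1_E z.
  rewrite /u fctE sqmodM sqmod_real -mulrBl; congr (_ * _).
  by rewrite indicE; case: (_ \in _); rewrite ?expr1n ?expr0n.
have u0 z : 0 <= u z.
  rewrite uE indicE; case: (boolP (z \in E)) => [/set_mem zE|_]; rewrite ?mulr0 ?mulr1 //.
  by rewrite subr_ge0 ltW.
have iu0 : \int[mu]_z u z = 0.
  apply/eqP; rewrite eq_le Rintegral_ge0 ?andbT //.
  rewrite circle_intB; [|exact: L2_Rintegrable|apply/RintegrableZ/L2_Rintegrable => //].
  by rewrite circle_intZ ?subr_le0; [exact: aK|exact: L2_Rintegrable].
have mue : measurable_fun setT (EFin \o u) by case/integrableP: iu.
have /(ae_eq_integral_abs mu measurableT mue) ae0 : (\int[mu]_z `|(EFin \o u) z| = 0)%E.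
  under eq_integral do rewrite /= ger0_norm ?u0 //.
  by rewrite EFin_int // iu0.
apply: norm_inf_le => //; apply: filterS ae0 => z /(_ I) [].
rewrite uE indicE => h; rewrite cabsE -[K]ger0_norm // -sqrtr_sqr ler_wsqrtr //.
rewrite leNgt; apply/negP => zE; move: h; rewrite mem_set // mulr1; lra.
Qed.

Lemma max_norm_inf_le a b (K : R) : Linf a -> Linf b -> 0 <= K ->
  opnorm (Sop a b) = K%:E -> Num.max (norm_inf a) (norm_inf b) <= K.
Proof.
move=> Ha Hb K0 SK; rewrite ge_max; apply/andP; split; apply: norm_inf_le_mul => //;
  apply: mul_bound_density => // _ [N [P ->]].
(* Multiplying by z^N replaces p by P, which lies in H^2. *)
- have := sqnorm_le_opnorm Ha Hb K0 SK (H2_poly P) H2perp_0.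
  rewrite sqnorm_0 addr0 sqnorm_ptrig sqnorm_ptrigM (_ : b * cst 0 = 0) ?addr0 //.
  by apply/funext => z; rewrite !fctE mulr0.
(* Taking [size P] as the negative shift makes all frequencies negative. *)
- have := sqnorm_le_opnorm Ha Hb K0 SK (H2_0 R) (H2perp_ptrig (leqnn (size P))).
  rewrite sqnorm_0 add0r !sqnorm_ptrig sqnorm_ptrigM (_ : a * cst 0 = 0) ?add0r ?sqnorm_ptrigM //.
  by apply/funext => z; rewrite !fctE mulr0.
Qed.

(* Approximating [h] by a trigonometric polynomial and dropping the negative
   frequencies of the latter only improves the approximation. *)
Lemma H2_approx_poly h (e : R) : H2 h -> 0 < e ->
  exists P, sqnorm (h - (fun z => P.[z])) < e.
Proof.
move=> Hh e0; have [_ /(_ _ e0) [_ [N [P ->]] hp]] := L2_approximable (H2_L2 Hh).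
exists (drop_poly N P); apply: le_lt_trans hp.
pose u : Fun := h - (fun z => (drop_poly N P).[z]); rewrite -/u; pose v := @ptrig R N (take_poly N P).
have Hu : H2 u by apply: H2B => //; exact: H2_poly.
have Hv : H2perp v by apply: H2perp_ptrig; exact: size_take_poly.
rewrite (_ : h - ptrig N P = u - v).
  rewrite sqnormB //; [|by auto|by auto].
  rewrite (cdotC (H2perp_L2 Hv) (H2_L2 Hu)) Hv.2 // rmorph0 mulr0 subr0.
  by rewrite lerDl sqnorm_ge0.
apply/funext => z; rewrite /u /v /ptrig !fctE.
rewrite -{1}(poly_take_drop N P) hornerD hornerM hornerXn mulrDr.
rewrite mulrCA mulVf ?mulr1 ?expf_neq0 ?circle_neq0 //; ring.
Qed.

(** If h is a polynomial, the coefficient of f h at n < 0 combines coefficients of f at indices n -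
    i < 0, which vanish. The general case follows by approximation, with Cauchy-Schwarz against z^n
    bounding the error. *)
Lemma Hinf_mul f h : Hinf f -> H2 h -> H2 (f * h).
Proof.
move=> [[Hf f0] If] Hh; have Hfh := L2_LinfM If (H2_L2 Hh).
split=> // n n0; apply: sqmod_eq0; apply/eqP; rewrite eq_le sqmod_ge0 andbT.
apply/ler_addgt0Pr => e e0; rewrite add0r; set A := norm_inf f ^+ 2.
have c0 : 0 < A + 1 by rewrite ltr_wpDl ?sqr_ge0.
have [P hP] := H2_approx_poly Hh (divr_gt0 e0 c0).
set p : Fun := fun z => P.[z] in hP.
have Hp : L2 p by exact/H2_L2/H2_poly.
have Hhp := L2B (H2_L2 Hh) Hp.
have He := L2_expz R n.
have fp0 : fourier (f * p) n = 0.
  rewrite (_ : f * p = \sum_(i < size P) (fun z => P`_i * (f z * (z : C) ^ i))); last first.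
    apply/funext => z; rewrite /p fctE fct_sumE horner_coef mulr_sumr.
    by apply: eq_bigr => i _; rewrite mulrCA.
  (* Membership in L^2 is carried along in the induction, because additivity of the inner product
     requires it. *)
  suff [] : L2 (\sum_(i < size P) (fun z : T => P`_i * (f z * (z : C) ^ i))) /\
    fourier (\sum_(i < size P) (fun z : T => P`_i * (f z * (z : C) ^ i))) n = 0 by [].
  elim/big_rec: _ => [|i g _ [Hg g0]]; first by split; [exact: L2_cst|exact: cdot0l].
  have Hi : L2 (fun z : T => f z * (z : C) ^ i) by apply: (L2_LinfM If (L2_expz R i)).
  have HPi := L2Z P`_i Hi.
  split; first exact: L2D.
  rewrite /fourier cdotDl // -/(fourier g n) g0 addr0 cdotZl //.
  have -> : cdot (fun z : T => f z * (z : C) ^ i) (fun z => (z : C) ^ n) = fourier f (n - i%:Z).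
    rewrite /fourier /cdot; congr cintegral; apply/funext => z.
    by rewrite !conj_expz -mulrA -expfzDr ?circle_neq0 // opprB.
  by rewrite f0 ?mulr0 // subr_lt0 (lt_le_trans n0).
rewrite (_ : f * h = f * p + f * (h - p)); last by rewrite -mulrDr addrC subrK.
have Hfp : L2 (f * p) by exact: L2_LinfM.
have Hfhp : L2 (f * (h - p)) by exact: L2_LinfM.
rewrite /fourier cdotDl // -/(fourier _ _) fp0 add0r.
apply: le_trans (cauchy_schwarz Hfhp He) _.
rewrite sqnorm_expz mulr1.
apply: le_trans (sqnorm_LinfM If Hhp) _; rewrite -/A.
move: hP; rewrite ltr_pdivlMr // mulrDr mulr1 mulrC => /ltW; apply: le_trans.
by rewrite lerDl sqnorm_ge0.
Qed.

End OperatorNorm.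

(** * Continuity in the symbols and the two exact norm formulas *)

Section NormFormulas.
Variable R : realType.
Local Notation T := (circle R).
Local Notation mu := (circle_measure R).
Local Notation C := R[i].
Local Notation Fun := (T -> C).
Local Notation Re := complex.Re.
Local Notation Im := complex.Im.
Implicit Types (a b f g h p q : Fun).
#[local] Hint Resolve H2_L2 H2perp_L2 : core.

Lemma opnorm_Sop_cvg a b (a_ b_ : nat -> Fun) : Linf a -> Linf b ->
  (forall n, Linf (a_ n)) -> (forall n, Linf (b_ n)) ->
  norm_inf (a_ n - a) @[n --> \oo] --> (0 : R) ->
  norm_inf (b_ n - b) @[n --> \oo] --> (0 : R) ->
  opnorm (fun f => Sop (a_ n) (b_ n) f - Sop a b f) @[n --> \oo] --> 0%E.
Proof.
move=> Ha Hb Ha_ Hb_ a_a b_b.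
pose S n f := Sop (a_ n) (b_ n) f - Sop a b f.
have ub n : (opnorm (S n) <= (norm_inf (a_ n - a) + norm_inf (b_ n - b))%:E)%E.
  (* Both operators use the same [projP f], so their difference is again of the form [Sop]. *)
  have -> : S n = Sop (a_ n - a) (b_ n - b).
    by apply/funext => f; apply/funext => z; rewrite /S /Sop !fctE; ring.
  apply: le_trans (opnorm_Sop_ub (LinfB (Ha_ n) Ha) (LinfB (Hb_ n) Hb)) _.
  have A0 := norm_inf_ge0 (a_ n - a); have B0 := norm_inf_ge0 (b_ n - b).
  (* Comparing squares gives sqrt (A^2 + B^2) <= A + B. *)
  rewrite lee_fin -[leRHS]ger0_norm ?addr_ge0 // -sqrtr_sqr ler_wsqrtr //.
  by rewrite sqrrD lerD2r lerDl mulrn_wge0 // mulr_ge0.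
apply: (@squeeze_cvge _ _ _ _ (cst 0%E) _
  (fun n => (norm_inf (a_ n - a) + norm_inf (b_ n - b))%:E)).
- by apply: nearW => n; rewrite opnorm_ge0 ub.
- exact: cvg_cst.
- apply: cvg_EFin; first exact: nearW.
  by rewrite -(addr0 (0 : R)); exact: cvgD.
Qed.

Lemma opnorm_Sop_lb a b : Linf a -> Linf b ->
  ((Num.max (norm_inf a) (norm_inf b))%:E <= opnorm (Sop a b))%E.
Proof.
move=> Ha Hb; have [K K0 SK] := opnorm_Sop_fin Ha Hb.
by rewrite SK lee_fin; exact: max_norm_inf_le.
Qed.

Lemma opnorm_Sop_analytic a b : Linf a -> Linf b -> Hinf (fun z => a z * (b z)^*) ->
  opnorm (Sop a b) = (Num.max (norm_inf a) (norm_inf b))%:E.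
Proof.
move=> Ha Hb Hab; apply/eqP; rewrite eq_le opnorm_Sop_lb // andbT.
set M := Num.max _ _.
have [AM BM] : norm_inf a <= M /\ norm_inf b <= M by rewrite !le_max !lexx orbT.
have A0 := norm_inf_ge0 a; have B0 := norm_inf_ge0 b.
have M0 : 0 <= M by exact: le_trans AM.
apply: opnorm_ub => // f Hf; split; first exact: L2_Sop.
have HP := projP_H2 f; have HQ := projQ_L2 Hf.
rewrite SopE sqnormD; [|by apply: L2_LinfM; auto|by apply: L2_LinfM; auto].
rewrite (_ : cdot _ _ = 0) /= ?mulr0 ?addr0.
  rewrite (sqnorm_projPQ Hf) [leRHS]mulrDr.
  have n2M c g : Linf c -> norm_inf c <= M -> L2 g -> sqnorm (c * g) <= M ^+ 2 * sqnorm g.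
    move=> Hc cM Hg; apply: le_trans (sqnorm_LinfM Hc Hg) _.
    by rewrite ler_wpM2r ?sqnorm_ge0 // lerXn2r ?nnegrE ?norm_inf_ge0.
  by apply: lerD; apply: n2M => //; auto.
transitivity (cdot ((fun z => a z * (b z)^*) * projP f) (projQ f)).
  by congr cintegral; apply/funext => z; rewrite !fctE rmorphM; ring.
have HabP := Hinf_mul Hab HP.
(* Either Q f is orthogonal to H^2, which contains the product on the left, or P f is the default
   0. *)
have [HQp|->] := projQ_perp f.
  by rewrite (cdotC HQ (H2_L2 HabP)) HQp.2 // rmorph0.
rewrite (_ : _ * cst 0 = cst 0) ?cdot0l //.
by apply/funext => z; rewrite !fctE mulr0.
Qed.

(* The extremal vector is [h + q / c^2]: on it both terms of the operator
   coincide with [a h]. *)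
Lemma opnorm_Sop_quotient a b (c : R) q h : Linf a -> Linf b ->
  {ae mu, forall z, cabs (a z) = c /\ cabs (b z) = c} ->
  H2perp q -> H2 h -> ~ {ae mu, forall z, h z = 0} ->
  {ae mu, forall z, a z * (b z)^* = q z / h z} ->
  opnorm (Sop a b) = (Num.sqrt (norm_inf a ^+ 2 + norm_inf b ^+ 2))%:E.
Proof.
move=> Ha Hb abc Hq Hh h0 abq.
have [K K0 SK] := opnorm_Sop_fin Ha Hb.
apply/eqP; rewrite eq_le opnorm_Sop_ub // SK lee_fin.
(* If c <= 0, both symbols are null and the claim reads 0 <= K. *)
have [c0|c0] := leP c 0.
  have az d : Linf d -> {ae mu, forall z, cabs (d z) = c} -> norm_inf d = 0.
    move=> Hd dc; apply/eqP; rewrite eq_le norm_inf_ge0 andbT norm_inf_le //.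
    by apply: filterS dc => z ->.
  rewrite (az a) //; last by apply: filterS abc => z [].
  by rewrite (az b) ?expr0n ?addr0 ?sqrtr0 //; apply: filterS abc => z [].
have ac : norm_inf a <= c by apply: norm_inf_le => //; apply: filterS abc => z [->].
have bc : norm_inf b <= c by apply: norm_inf_le => //; apply: filterS abc => z [_ ->].
have qE : {ae mu, forall z, q z = a z * (b z)^* * h z}.
  (* Where h vanishes the quotient q / h is 0 by convention, while |a| |b| = c^2 > 0; so h is
     nonzero at almost every point and the division can be undone. *)
  apply: filterS2 abc abq => z [az bz] abz; rewrite abz divfK //.
  apply/eqP => hz; move: abz; rewrite hz invr0 mulr0 => /(congr1 (@sqmod R)).
  rewrite sqmodM sqmodJ -(sqr_cabs (a z)) -(sqr_cabs (b z)) az bz.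
  rewrite [RHS](_ : _ = 0); last by rewrite /sqmod /= expr0n addr0.
  by move/eqP; rewrite mulf_eq0 !expf_eq0 /= gt_eqF.
pose g z := ((c ^+ 2)^-1)%:C * q z.
have Hg : H2perp g by exact: H2perpZ.
have := sqnorm_le_opnorm Ha Hb K0 SK Hh Hg.
have HS : L2 (a * h + b * g) by apply: L2D; apply: L2_LinfM; auto.
have Hah : L2 (a * h) by apply: L2_LinfM; auto.
have c2 : c ^+ 2 != 0 by rewrite expf_neq0 // gt_eqF.
rewrite (@sqnorm_ae _ _ (fun z => 2%:C * (a * h) z) HS); last 2 first.
- exact: L2Z.
- apply: filterS2 abc qE => z [_ bz] qz; rewrite /g !fctE qz.
  rewrite (_ : b z * _ = ((c ^+ 2)^-1)%:C * (b z * (b z)^*) * (a z * h z)); last by ring.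
  by rewrite mulcJ -sqr_cabs bz -rmorphM mulVf // rmorph1 rmorph_nat; ring.
rewrite sqnormZ // sqmod_real.
have n2ah : sqnorm (a * h) = c ^+ 2 * sqnorm h.
  rewrite -(sqmod_real c) -sqnormZ; last exact: H2_L2.
  have HI : L2 (fun z => c%:C * h z) by apply: L2Z; auto.
  rewrite /sqnorm /Rintegral; congr fine.
  apply: ae_eq_integral => //; [exact/measurable_EFinP/cmeas_sqmod/L2_cmeasurable..|].
  by apply: filterS abc => z [az _] _; rewrite fctE !sqmodM -sqr_cabs az sqmod_real.
have n2g : sqnorm g = sqnorm h.
  rewrite -[RHS]mul1r -[X in X * _](_ : sqmod (1 : C) = 1); last by rewrite /sqmod /=; ring.
  rewrite -sqnormZ; last exact: H2_L2.
  have HI : L2 (fun z => 1 * h z) by apply: L2Z; auto.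
  have Hg2 : L2 g by auto.
  rewrite /sqnorm /Rintegral; congr fine.
  apply: ae_eq_integral => //; [exact/measurable_EFinP/cmeas_sqmod/L2_cmeasurable..|].
  apply: filterS2 abc qE => z [az bz] qz _; rewrite /g qz !sqmodM sqmodJ -!sqr_cabs az bz.
  by rewrite !sqr_cabs sqmod_real /sqmod /=; congr (_%:E); field; rewrite gt_eqF.
rewrite n2ah n2g.
(* As h is not null, |h|^2 can be cancelled, leaving 4 c^2 <= 2 K^2. *)
have hp : 0 < sqnorm h.
  rewrite lt_def sqnorm_ge0 andbT; apply/eqP => hz; apply: h0.
  by apply: sqnorm_eq0 => //; auto.
rewrite (_ : K ^+ 2 * (sqnorm h + sqnorm h) = 2 * K ^+ 2 * sqnorm h); last by ring.
rewrite mulrA ler_pM2r // => h1.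
rewrite -[K]ger0_norm // -sqrtr_sqr ler_wsqrtr //.
have A0 := norm_inf_ge0 a; have B0 := norm_inf_ge0 b.
have : norm_inf a ^+ 2 <= c ^+ 2 by rewrite lerXn2r ?nnegrE // ltW.
have : norm_inf b ^+ 2 <= c ^+ 2 by rewrite lerXn2r ?nnegrE // ltW.
move: h1; rewrite (_ : 2 ^+ 2 * _ = 4 * c ^+ 2); last by ring.
lra.
Qed.

End NormFormulas.

(** * An example with both inequalities strict *)

Section StrictInequalities.
Variable R : realType.
Local Notation T := (circle R).
Local Notation C := R[i].
Local Notation Fun := (T -> C).
Local Notation Re := complex.Re.

(** Multiplication by 1/z moves part of H^2 outside H^2 and so creates a cross term with Q f, while
    the constant 1 contributes none. *)
Let alpha : Fun := cst 1 + (fun z : T => (z : C) ^ (-1)).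
Let beta : Fun := cst 2.

Lemma cst_expz0 : (cst 1 : Fun) = (fun z : T => (z : C) ^ 0).
Proof. by apply/funext => z; rewrite expr0z. Qed.

Lemma sqnorm_one_add (c : C) : sqnorm (cst 1 + (fun z : T => c * (z : C) ^ (-1))) = 1 + sqmod c.
Proof.
have Hz := L2_expz R (-1); have H1 := L2_expz R 0.
rewrite cst_expz0 sqnormD //; last exact: L2Z.
rewrite sqnormZ // !sqnorm_expz cdotZr // cdot_expz /= mulr0 /=; ring.
Qed.

Lemma cabs_alpha z : cabs (alpha z) <= 2.
Proof.
apply: le_trans (le_normcD _ _) _.
rewrite ComplexField.Normc.normc1 cabsE sqmod_expz sqrtr1; lra.
Qed.

Lemma cabs_beta z : cabs (beta z) <= 2.
Proof. by rewrite cabsE (_ : sqmod _ = 2 ^+ 2) ?sqrtr_sqr ?ger0_norm // /sqmod /=; ring. Qed.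

Lemma Linf_alpha : Linf alpha.
Proof.
apply: (@Linf_ae _ 2); last by apply: aeW => z; exact: cabs_alpha.
by apply: cmeasD; [exact: cmeas_cst|exact: cmeas_expz].
Qed.

Lemma Linf_beta : Linf beta.
Proof.
by apply: (@Linf_ae _ 2); [exact: cmeas_cst|apply: aeW => z; exact: cabs_beta].
Qed.

Lemma norm_inf_alpha_le : norm_inf alpha <= 2.
Proof. by apply: (norm_inf_le Linf_alpha); apply: aeW => z; exact: cabs_alpha. Qed.

Lemma norm_inf_beta_le : norm_inf beta <= 2.
Proof. by apply: (norm_inf_le Linf_beta); apply: aeW => z; exact: cabs_beta. Qed.

Lemma sqnorm_one : sqnorm (cst 1 : Fun) = 1.
Proof. by rewrite cst_expz0 sqnorm_expz. Qed.

(** Tested on the constant 1, whose image 1 + 1/z has square norm 2. *)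
Lemma norm_inf_alpha_sqr_ge : 2 <= norm_inf alpha ^+ 2.
Proof.
have := sqnorm_LinfM Linf_alpha (L2_cst 1); rewrite sqnorm_one mulr1; apply: le_trans.
rewrite (_ : alpha * cst 1 = cst 1 + (fun z : T => 1 * (z : C) ^ (-1))).
  by rewrite sqnorm_one_add /sqmod /= expr0n /= addr0 expr1n; lra.
by apply/funext => z; rewrite /alpha !fctE mulr1 mul1r.
Qed.

Lemma norm_inf_beta_sqr_ge : 4 <= norm_inf beta ^+ 2.
Proof.
have := sqnorm_LinfM Linf_beta (L2_cst 1); rewrite sqnorm_one mulr1; apply: le_trans.
by rewrite sqnormZ ?sqnorm_one; [rewrite /sqmod /=; lra|exact: L2_cst].
Qed.

(** Take h = 1 and g = 1/z: the image 1 + 3/z of h + g has square norm 10, so 10 <= 2 K^2 and K^2 >=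
    5 > 4. *)
Lemma opnorm_alpha_beta_gt (K : R) : 0 <= K -> opnorm (Sop alpha beta) = K%:E -> 2 < K.
Proof.
move=> K0 SK.
have H1 : H2 (cst 1 : Fun) by rewrite cst_expz0; exact: H2_expz.
have Hz : H2perp (fun z : T => (z : C) ^ (-1)) by exact: H2perp_expz.
have := sqnorm_le_opnorm Linf_alpha Linf_beta K0 SK H1 Hz.
rewrite sqnorm_one sqnorm_expz (_ : _ + _ = cst 1 + (fun z : T => 3 * (z : C) ^ (-1))); last first.
  by apply/funext => z; rewrite /alpha /beta !fctE; ring.
rewrite sqnorm_one_add (_ : sqmod 3 = 9); last by rewrite /sqmod /=; ring.
nra.
Qed.

(** Since <P f, Q f> = 0, the cross term reduces to 2 <z^-1 P f, Q f>, which improves on the general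
    bound. The constant 7/2 is below 4, the square norm of [beta], yet large enough for the final
    quadratic form to be nonnegative. *)
Lemma opnorm_alpha_beta_le : (opnorm (Sop alpha beta) <= (Num.sqrt (norm_inf alpha ^+ 2 + 7 / 2))%:E)%E.
Proof.
have A2 := norm_inf_alpha_sqr_ge.
apply: opnorm_ub => [|f Hf]; first exact: sqrtr_ge0.
split; first exact: (L2_Sop Linf_alpha Linf_beta).
rewrite sqr_sqrtr; last by rewrite addr_ge0 ?sqr_ge0 // divr_ge0.
have HP := H2_L2 (projP_H2 f); have HQ := projQ_L2 Hf.
have HaP := L2_LinfM Linf_alpha HP; have HbQ := L2_LinfM Linf_beta HQ.
pose p' : Fun := (fun z : T => (z : C) ^ (-1)) * projP f.
have Hp' : L2 p' by apply: (@L2_bndM _ 1) => //; [exact: cmeas_expz|move=> z; rewrite sqmod_expz].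
have n2p' : sqnorm p' = sqnorm (projP f).
  by apply: eq_Rintegral => z _; rewrite /p' fctE sqmodM sqmod_expz mul1r.
have dE : cdot (alpha * projP f) (beta * projQ f) = 2 * cdot p' (projQ f).
  rewrite (_ : alpha * projP f = projP f + p'); last first.
    by apply/funext => z; rewrite /alpha /p' !fctE; ring.
  rewrite [LHS](@cdotZr _ 2) //; last exact: L2D.
  rewrite cdotDl // (cdotC HQ HP) cdot_projQP rmorph0 add0r.
  by rewrite rmorph_nat.
rewrite SopE sqnormD // (sqnorm_projPQ Hf) dE.
have hP := sqnorm_LinfM Linf_alpha HP.
have hQ : sqnorm (beta * projQ f) = 4 * sqnorm (projQ f).
  by rewrite sqnormZ //; congr (_ * _); rewrite /sqmod /=; ring.
have hd := Re_cdot_le Hp' HQ; rewrite n2p' in hd.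
have {hd}hd : Re (2 * cdot p' (projQ f)) <= 2 * (Num.sqrt (sqnorm (projP f)) * Num.sqrt (sqnorm (projQ f))).
  move: hd; rewrite ler_norml => /andP[_ hd].
  rewrite (_ : Re _ = 2 * Re (cdot p' (projQ f))) ?ler_pM2l //.
  by case: (cdot _ _) => x y /=; ring.
rewrite hQ; move: hP hd.
rewrite -{1 3}(sqr_sqrtr (sqnorm_ge0 (projP f))) -{2 3}(sqr_sqrtr (sqnorm_ge0 (projQ f))).
move: (Num.sqrt _) (Num.sqrt _) (sqnorm _) (Re _) A2 => y x s r A2 hP hd.
set A := norm_inf alpha ^+ 2 in A2 hP *.
(* The form 7/2 x^2 - 4 x y + (A - 1/2) y^2 becomes a sum of squares with nonnegative coefficients
   because A >= 2; the 4/7 completes the square in x. *)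
have e1 : 0 <= 7 / 2 * (x - 4 / 7 * y) ^+ 2 by rewrite mulr_ge0 ?sqr_ge0 // divr_ge0.
have e2 : 0 <= (A - 2) * y ^+ 2 by rewrite mulr_ge0 ?sqr_ge0 ?subr_ge0.
have e3 : 0 <= y ^+ 2 by exact: sqr_ge0.
have e4 : (A + 7 / 2) * (x ^+ 2 + y ^+ 2) - (A * x ^+ 2 + 4 * y ^+ 2 + 2 * (2 * (x * y))) =
  7 / 2 * (x - 4 / 7 * y) ^+ 2 + (A - 2) * y ^+ 2 + 5 / 14 * y ^+ 2 by field.
lra.
Qed.

Lemma exists_opnorm_strict : exists al be : Fun,
    [/\ Linf al, Linf be,
        ((Num.max (norm_inf al) (norm_inf be))%:E < opnorm (Sop al be))%E &
        (opnorm (Sop al be)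
           < (Num.sqrt (norm_inf al ^+ 2 + norm_inf be ^+ 2))%:E)%E].
Proof.
exists alpha, beta; split; [exact: Linf_alpha|exact: Linf_beta| |].
  have [K K0 SK] := opnorm_Sop_fin Linf_alpha Linf_beta.
  rewrite SK lte_fin; apply: le_lt_trans (opnorm_alpha_beta_gt K0 SK).
  by rewrite ge_max norm_inf_alpha_le norm_inf_beta_le.
(* Strictness comes from 7/2 < 4 <= [norm_inf beta ^+ 2]. *)
apply: le_lt_trans opnorm_alpha_beta_le _; rewrite lte_fin ltr_sqrt; have := norm_inf_beta_sqr_ge; have := norm_inf_alpha_sqr_ge; lra.
Qed.

End StrictInequalities.

Theorem theorem3p1 (R : realType) :
  (forall alpha beta : circle R -> R[i], Linf alpha -> Linf beta ->
    [/\ (forall alpha_ beta_ : nat -> circle R -> R[i],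
           (forall n, Linf (alpha_ n)) -> (forall n, Linf (beta_ n)) ->
           norm_inf (alpha_ n - alpha) @[n --> \oo] --> (0 : R) ->
           norm_inf (beta_ n - beta) @[n --> \oo] --> (0 : R) ->
           opnorm (fun f => Sop (alpha_ n) (beta_ n) f - Sop alpha beta f)
             @[n --> \oo] --> 0%E),
        ((Num.max (norm_inf alpha) (norm_inf beta))%:E
           <= opnorm (Sop alpha beta))%E /\
        (opnorm (Sop alpha beta)
           <= (Num.sqrt (norm_inf alpha ^+ 2 + norm_inf beta ^+ 2))%:E)%E,
        (Hinf (fun z => alpha z * (beta z)^*) ->
           opnorm (Sop alpha beta)
           = (Num.max (norm_inf alpha) (norm_inf beta))%:E) &
        ((exists c : R, {ae circle_measure R, forall z,
             cabs (alpha z) = c /\ cabs (beta z) = c}) ->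
         (exists q h : circle R -> R[i],
            [/\ H2perp q, H2 h,
                ~ {ae circle_measure R, forall z, h z = 0} &
                {ae circle_measure R, forall z,
                  alpha z * (beta z)^* = q z / h z}]) ->
         opnorm (Sop alpha beta)
         = (Num.sqrt (norm_inf alpha ^+ 2 + norm_inf beta ^+ 2))%:E)]) /\
  (exists alpha beta : circle R -> R[i],
    [/\ Linf alpha, Linf beta,
        ((Num.max (norm_inf alpha) (norm_inf beta))%:E
           < opnorm (Sop alpha beta))%E &
        (opnorm (Sop alpha beta)
           < (Num.sqrt (norm_inf alpha ^+ 2 + norm_inf beta ^+ 2))%:E)%E]).
Proof.
split=> [al be Ha Hb|]; last exact: exists_opnorm_strict.
split; [|split|exact: opnorm_Sop_analytic|].
- by move=> al_ be_; exact: opnorm_Sop_cvg.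
- exact: opnorm_Sop_lb.
- exact: opnorm_Sop_ub.
- by move=> [c abc] [q [h [Hq Hh h0 abq]]]; exact: (opnorm_Sop_quotient Ha Hb abc Hq Hh h0 abq).
Qed.
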